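(* Let $K$ be an algebraically closed field of arbitrary characteristic, $n\ge 1$ and $r,s\geq 0$ integers. Let $\{C^{\lambda}_{S,T}\mid \lambda\in\Lambda^+(n,r+(n-1)s)\}$ be any cellular basis of the Schur algebra $S(n,r+(n-1)s)$, with respect to the set $\Lambda^+(n,r+(n-1)s)$ ordered by the reverse dominance order. Under the quotient map $S(n,r+(n-1)s)\to S(n,r,s)$, the images of all $C^\lambda_{S,T}$, for $\lambda=(\lambda_1,\ldots,\lambda_n)\in\Lambda^+(n,r+(n-1)s)$ satisfying the condition $\sum_{i\in R^+_\lambda}\lambda_i\le r+|R^+_\lambda|s$, form a cellular basis of the rational Schur algebra $S(n,r,s)$. Here $R^+_\lambda=\{1\le i\le n\mid\lambda_i>s\}$.
   Context: $G=\mathrm{GL}(n)$ over $K$; $c_{ij}$ are the coordinate functions of the generic matrix $C$, $d_{ij}$ the entries of $C^{-1}$, $D=\det C$. $A(n,d)$ is the space of homogeneous polynomials of degree $d$ in the $c_{ij}$, and the Schur algebra is $S(n,d)=A(n,d)^*$. $A(n,r,s)\subset K[G]$ is the subcoalgebra spanned by all $\prod c_{ij}^{a_{ij}}\prod d_{ij}^{b_{ij}}$ with $\sum a_{ij}=r$, $\sum b_{ij}=s$, and the rational Schur algebra is $S(n,r,s)=A(n,r,s)^*$. The quotient map $S(n,r+(n-1)s)\to S(n,r,s)$ is the surjective algebra map dual to the injective coalgebra map $A(n,r,s)\to A(n,r+(n-1)s)$, $a\mapsto D^s a$ (it corresponds to tensoring $S(n,r,s)$-modules with the $s$-th power of the determinant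 representation). $\Lambda^+(n,d)$ is the set of $\lambda\in\mathbb{Z}^n$ with $\lambda_1\ge\cdots\ge\lambda_n\geq 0$ and $\sum\lambda_i=d$. Dominance: $\kappa\unrhd\mu$ means $\sum_{i\le k}\kappa_i\ge\sum_{i\le k}\mu_i$ for all $k$ (with equality for $k=n$). ''Cellular basis'' of an algebra $A$ with respect to a finite set $\nu$ of weights is in the sense of Graham and Lehrer: for each $\lambda\in\nu$ there is a finite index set $M(\lambda)$ such that the $C^\lambda_{S,T}$ ($\lambda \in \nu$, $S,T\in M(\lambda)$) form a basis of $A$, the linear map $C^\lambda_{S,T}\mapsto C^\lambda_{T,S}$ is an anti-automorphism, and left multiplication satisfies $a\,C^\lambda_{S,T}\equiv\sum_{S'}r_a(S',S)C^\lambda_{S',T}$ modulo the span of the $C^{\kappa}_{U,V}$ with $\kappa\rhd\lambda$, with $r_a(S',S)$ independent of $T$. For $S(n,r+(n-1)s)$ the cell module labelled by $\lambda$ is the standard (Weyl) module $\Delta(\lambda)$ of highest weight $\lambda$. *)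

(* Defs.v *)
From HB Require Import structures.
From mathcomp Require Import all_boot all_order all_fingroup all_algebra all_field.
From mathcomp Require Import boolp functions.

Set Implicit Arguments.
Unset Strict Implicit.
Unset Printing Implicit Defensive.

Import Order.TTheory GRing.Theory.
Local Open Scope ring_scope.

Section MaxSubspace.
Variables (K : fieldType) (V : vectType K) (P : {pred V}).

Lemma vspace_of_submod :
  submod_closed P -> exists U : {vspace V}, forall v, (v \in U) = (v \in P).
Proof.
case=> P0 PD.
pose Q d := `[< exists U : {vspace V}, \dim U = d /\ {subset U <= P} >].
have Q0 : exists d, Q d.
  exists 0%N; apply/asboolP; exists 0%VS; split; first by rewrite dimv0.
  by move=> v; rewrite memv0 => /eqP->.
have Qb d : Q d -> (d <= \dim {:V})%N.
  by move=> /asboolP [U [<- _]]; exact: dimvS (subvf U).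
case: (ex_maxnP Q0 Qb) => d /asboolP [U [dU sU]] dmax.
exists U => v; apply/idP/idP; first exact: sU.
move=> Pv; apply: contraT => nUv.
have /dmax : Q (\dim (U + <[v]>)).
  apply/asboolP; exists (U + <[v]>)%VS; split=> // w /memv_addP [u Uu [z]].
  by case/vlineP=> k -> ->; rewrite addrC; apply: PD => //; apply: sU.
rewrite -dU => le; case/negP: nUv.
have /eqP : U == (U + <[v]>)%VS by rewrite eqEdim addvSl le.
by move=> ->; rewrite memvE addvSr.
Qed.

End MaxSubspace.

(* The space of functions X -> K spanned by a finite family b, as a vectType. *)
Section FunSpan.
Import VectorInternalTheory.
Variables (K : fieldType) (X : Type) (I : finType) (b : I -> X -> K^o).

Definition fspan_pred : {pred X -> K^o} :=
  fun f => `[< exists c : {ffun I -> K^o}, f = \sum_i c i *: b i >].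

Lemma fspanP f :
  reflect (exists c : {ffun I -> K^o}, f = \sum_i c i *: b i)
          (f \in fspan_pred).
Proof. exact: asboolP. Qed.

Definition fcomb (c : {ffun I -> K^o}) : X -> K^o := \sum_i c i *: b i.

Lemma fcomb_linear : linear fcomb.
Proof.
move=> k c d; rewrite /fcomb scaler_sumr -big_split; apply: eq_bigr => i _ /=.
by rewrite !ffunE scalerDl scalerA.
Qed.
HB.instance Definition _ :=
  GRing.isLinear.Build K {ffun I -> K^o} (X -> K^o) _ fcomb fcomb_linear.

Fact fspan_submod : submod_closed fspan_pred.
Proof.
split; first by apply/fspanP; exists 0; rewrite -/(fcomb 0) raddf0.
move=> k _ _ /fspanP [c ->] /fspanP [d ->]; apply/fspanP.
by exists (k *: c + d); rewrite -!/(fcomb _) linearP.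
Qed.
HB.instance Definition _ :=
  GRing.isSubmodClosed.Build K (X -> K^o) fspan_pred fspan_submod.

Lemma mem_fspan i : b i \in fspan_pred.
Proof.
apply/fspanP; exists [ffun j => (j == i)%:R].
rewrite (bigD1 i) //= ffunE eqxx scale1r big1 ?addr0 // => j /negbTE ji.
by rewrite ffunE ji scale0r.
Qed.

Record fspan := FSpan { fspan_val :> X -> K^o; _ : fspan_val \in fspan_pred }.
HB.instance Definition _ := [isSub for fspan_val].
HB.instance Definition _ := [Choice of fspan by <:].
HB.instance Definition _ := [SubChoice_isSubZmodule of fspan by <:].
HB.instance Definition _ := [SubZmodule_isSubLmodule of fspan by <:].

Fact fspan_vect_axiom : {n & Vector.axiom n fspan}.
Proof.
pose Z : {pred {ffun I -> K^o}} := fun c => fcomb c == 0.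
have Zsub : submod_closed Z.
  split; first by apply/eqP; rewrite raddf0.
  by move=> k c d /eqP c0 /eqP d0; apply/eqP; rewrite fcomb_linear c0 d0 scaler0 addr0.
have [N NE] := cid (vspace_of_submod Zsub).
pose W := (N^C)%VS.
have sp c : fcomb c \in fspan_pred by apply/fspanP; exists c.
pose phi (u : subvs_of W) : fspan := FSpan (sp (vsval u)).
have phiL : linear phi.
  by move=> k u v; apply: val_inj; exact: (fcomb_linear k (vsval u) (vsval v)).
have phi0 u : phi u = 0 -> u = 0.
  move=> /(congr1 val) /= u0; apply: val_inj.
  have : vsval u \in (N :&: W)%VS.
    by rewrite memv_cap subvsP andbT NE; apply/eqP.
  by rewrite capv_compl memv0 => /eqP; apply.
have phiS f : exists u, phi u = f.
  case: f => f fP; have /fspanP [c fc] := fP.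
  have : c \in (N + W)%VS by rewrite addv_complf memvf.
  case/memv_addP => d Nd [w Ww cdw]; exists (Subvs Ww); apply: val_inj => /=.
  move: Nd; rewrite NE => /eqP d0.
  by rewrite fc -/(fcomb c) cdw -[d]scale1r fcomb_linear d0 scaler0 add0r.
pose psi f := sval (cid (phiS f)).
have psiK : cancel psi phi by move=> f; rewrite /psi; case: cid.
pose phiLin : {linear _ -> _} :=
  HB.pack phi (GRing.isLinear.Build K _ _ _ phi phiL).
have phiI : injective phi.
  move=> u v uv; apply/eqP; rewrite -subr_eq0; apply/eqP/phi0.
  by apply/eqP; rewrite -[phi]/(phiLin : _ -> _) raddfB subr_eq0; apply/eqP.
have phiK : cancel phi psi by move=> u; apply: phiI; rewrite psiK.
have VL : linear (@v2r K (subvs_of W)).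
  by move=> k u v; rewrite linearP.
exists (dim (subvs_of W)), (v2r \o psi).
  move=> k f g; rewrite /comp.
  have -> : psi (k *: f + g) = k *: psi f + psi g.
    by apply: phiI; rewrite phiL !psiK.
  exact: VL.
exists (phi \o r2v) => x /=.
  by rewrite v2rK psiK.
by rewrite phiK r2vK.
Qed.
HB.instance Definition _ :=
  Lmodule_hasFinDim.Build K fspan (projT2 fspan_vect_axiom).

End FunSpan.

(* K[GL_n] is realised as functions on the K-points of GL_n; this is the       *)
(* coordinate ring only for infinite K, in particular for K algebraically     *)
(* closed.                                                                    *)
Definition GL (K : fieldType) (n : nat) := {x : 'M[K]_n | x \in unitmx}.

HB.instance Definition _ (K : fieldType) n := SubChoice.on (GL K n).

Section GLGroup.
Variables (K : fieldType) (n : nat).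
Implicit Types x y : GL K n.

Fact gl_one_subproof : (1%:M : 'M[K]_n) \in unitmx.
Proof. exact: unitmx1. Qed.
Definition gl_one : GL K n := Sub 1%:M gl_one_subproof.

Fact gl_mul_subproof x y : val x *m val y \in unitmx.
Proof. by rewrite unitmx_mul (valP x) (valP y). Qed.
Definition gl_mul x y : GL K n := Sub (val x *m val y) (gl_mul_subproof x y).

Fact gl_inv_subproof x : invmx (val x) \in unitmx.
Proof. by rewrite unitmx_inv (valP x). Qed.
Definition gl_inv x : GL K n := Sub (invmx (val x)) (gl_inv_subproof x).

Fact gl_mulA : associative gl_mul.
Proof. by move=> x y z; apply: val_inj; rewrite /= mulmxA. Qed.
Fact gl_mul1 : left_id gl_one gl_mul.
Proof. by move=> x; apply: val_inj; rewrite /= mul1mx. Qed.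
Fact gl_mulr1 : right_id gl_one gl_mul.
Proof. by move=> x; apply: val_inj; rewrite /= mulmx1. Qed.
Fact gl_mulV : left_inverse gl_one gl_inv gl_mul.
Proof. by move=> x; apply: val_inj; rewrite /= mulVmx // (valP x). Qed.
Fact gl_mulrV : right_inverse gl_one gl_inv gl_mul.
Proof. by move=> x; apply: val_inj; rewrite /= mulmxV // (valP x). Qed.

HB.instance Definition _ :=
  isGroup.Build (GL K n) gl_mulA gl_mul1 gl_mulr1 gl_mulV gl_mulrV.

End GLGroup.

Section Coordinates.
Variables (K : fieldType) (n : nat).

(* Exponent matrices of total degree r; each exponent is then at most r. *)
Definition expo (r : nat) :=
  {a : {ffun 'I_n * 'I_n -> 'I_r.+1} | (\sum_p a p == r)%N}.
HB.instance Definition _ r := SubFinite.on (expo r).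

(* \prod c_ij ^ a_ij * \prod d_ij ^ b_ij for m = (a, b). *)
Definition ratmon r s (m : expo r * expo s) : GL K n -> K^o :=
  fun x => (\prod_p val x p.1 p.2 ^+ val m.1 p)
         * (\prod_p val x^-1%g p.1 p.2 ^+ val m.2 p).

(* A(n,r,s) *)
Definition ratcoord r s := fspan (@ratmon r s).
HB.instance Definition _ r s := Vector.on (ratcoord r s).
HB.instance Definition _ r s := SubChoice.on (ratcoord r s).

Let ratP r s := fspan_pred (@ratmon r s).

Let wd r := r.-tuple ('I_n * 'I_n)%type.
(* The same monomials as products over words of index pairs, which makes      *)
(* the comultiplication explicit.                                             *)
Definition wmon r s (u : wd r) (v : wd s) : GL K n -> K^o :=
  fun x => (\prod_(t < r) val x (tnth u t).1 (tnth u t).2)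
         * (\prod_(t < s) val x^-1%g (tnth v t).1 (tnth v t).2).

Lemma expo_word r (a : expo r) : exists u : wd r,
  forall F : 'I_n * 'I_n -> K, \prod_p F p ^+ val a p = \prod_(t < r) F (tnth u t).
Proof.
pose l := flatten [seq nseq (val a p) p | p <- enum {: 'I_n * 'I_n}].
have sl : size l == r.
  rewrite size_flatten /shape -map_comp sumnE big_map big_enum /=.
  by apply/eqP; rewrite -[RHS](eqP (valP a)); apply: eq_bigr => p _; rewrite size_nseq.
exists (Tuple sl) => F.
rewrite -(big_tuple _ _ (Tuple sl) xpredT F) /= big_flatten big_map big_enum.
by apply: eq_bigr => p _ /=; rewrite big_nseq -Monoid.iteropE.
Qed.

Lemma word_expo r (u : wd r) : exists a : expo r,
  forall F : 'I_n * 'I_n -> K, \prod_(t < r) F (tnth u t) = \prod_p F p ^+ val a p.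
Proof.
pose c p := #|[pred t | tnth u t == p]|.
have cr p : (c p < r.+1)%N by rewrite ltnS -[X in (_ <= X)%N]card_ord max_card.
have aP : (\sum_p ([ffun p => Ordinal (cr p)] : {ffun _ -> 'I_r.+1}) p == r)%N.
  rewrite (eq_bigr c) => [|p _]; last by rewrite ffunE.
  rewrite -[X in _ == X]card_ord -sum1_card.
  rewrite (partition_big (tnth u) xpredT) //=.
  by apply/eqP/eq_bigr => p _; rewrite /c -sum1_card.
exists (exist _ [ffun p => Ordinal (cr p)] aP) => F.
rewrite (partition_big (tnth u) xpredT) //=; apply: eq_bigr => p _.
rewrite ffunE /= /c -prodr_const; apply: eq_big => // t /eqP -> //.
Qed.

Lemma ratmon_word r s (m : expo r * expo s) :
  exists w : wd r * wd s, ratmon m = wmon w.1 w.2.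
Proof.
case: m => a b; have [u uE] := expo_word a; have [v vE] := expo_word b.
exists (u, v); apply/funext => x; rewrite /ratmon /wmon /=.
by rewrite (uE (fun p => val x p.1 p.2)) (vE (fun p => val x^-1%g p.1 p.2)).
Qed.

Lemma mem_wmon r s (u : wd r) (v : wd s) : wmon u v \in @ratP r s.
Proof.
have [a aE] := word_expo u; have [b bE] := word_expo v.
suff -> : wmon u v = ratmon (a, b) by exact: mem_fspan.
apply/funext => x; rewrite /ratmon /wmon /=.
by rewrite (aE (fun p => val x p.1 p.2)) (bE (fun p => val x^-1%g p.1 p.2)).
Qed.

Lemma ratP_ind r s (Q : (GL K n -> K^o) -> Prop) :
  (Q 0) -> (forall k f g, Q f -> Q g -> Q (k *: f + g)) ->
  (forall u v, Q (@wmon r s u v)) ->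
  forall f, f \in @ratP r s -> Q f.
Proof.
move=> Q0 QD Qw f /fspanP [c ->].
apply: big_ind => [//|g h Qg Qh|m _].
  by rewrite -[g]scale1r; apply: QD.
by have [w ->] := ratmon_word m; rewrite -[_ *: _]addr0; apply: QD.
Qed.

Lemma ratP_mul r1 s1 r2 s2 f g :
  f \in @ratP r1 s1 -> g \in @ratP r2 s2 ->
  (fun x => f x * g x) \in @ratP (r1 + r2) (s1 + s2).
Proof.
pose ratSub r s := fspan_submod (@ratmon r s).
move=> fP gP; elim/ratP_ind: f / fP => [|k f1 f2 P1 P2|u v].
- have -> : (fun x => (0 : GL K n -> K^o) x * g x) = 0.
    by apply/funext => x; rewrite mul0r.
  by case: (ratSub (r1 + r2)%N (s1 + s2)%N).
- have -> : (fun x => (k *: f1 + f2) x * g x) =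
            k *: (fun x => f1 x * g x : K^o) + (fun x => f2 x * g x).
    by apply/funext => x; rewrite mulrDl -mulrA.
  by case: (ratSub (r1 + r2)%N (s1 + s2)%N) => _; apply.
elim/ratP_ind: g / gP => [|k f1 f2 P1 P2|u' v'].
- have -> : (fun x => wmon u v x * (0 : GL K n -> K^o) x) = 0.
    by apply/funext => x; rewrite mulr0.
  by case: (ratSub (r1 + r2)%N (s1 + s2)%N).
- have -> : (fun x => wmon u v x * (k *: f1 + f2) x) =
     k *: (fun x => wmon u v x * f1 x : K^o) + (fun x => wmon u v x * f2 x).
    by apply/funext => x; rewrite mulrDr [_ * (_ *: _) x]mulrCA.
  by case: (ratSub (r1 + r2)%N (s1 + s2)%N) => _; apply.
have -> : (fun x => wmon u v x * wmon u' v' x) = wmon (cat_tuple u u') (cat_tuple v v').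
  apply/funext => x; rewrite /wmon !big_split_ord /=.
  rewrite mulrACA; congr (_ * _ * (_ * _)); apply: eq_bigr => t _;
    by rewrite ?tnth_lshift ?tnth_rshift.
exact: mem_wmon.
Qed.

Lemma ratP_comult r s f : f \in @ratP r s ->
  exists l : seq (ratcoord r s * ratcoord r s),
    forall x y, f (x * y)%g = \sum_(gh <- l) gh.1 x * gh.2 y.
Proof.
elim/ratP_ind => [|k f1 f2 [l1 P1] [l2 P2]|u v].
- by exists [::] => x y; rewrite big_nil.
- exists ([seq (k *: gh.1, gh.2) | gh <- l1] ++ l2) => x y.
  rewrite -[LHS]/(k * f1 (x * y)%g + f2 (x * y)%g) P1 P2 big_cat big_map.
  congr (_ + _); rewrite mulr_sumr.
  by apply: eq_bigr => gh _; rewrite mulrA.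
pose iT m := {ffun 'I_m -> 'I_n}.
pose wl m (w : wd m) (p : iT m) : wd m := [tuple ((tnth w t).1, p t) | t < m].
pose wr m (w : wd m) (p : iT m) : wd m := [tuple (p t, (tnth w t).2) | t < m].
pose mk (u : wd r) (v : wd s) : ratcoord r s := FSpan (mem_wmon u v).
exists [seq (mk (wl _ u pq.1) (wr _ v pq.2), mk (wr _ u pq.1) (wl _ v pq.2))
        | pq <- enum {: iT r * iT s}] => x y.
rewrite big_map big_enum /= /wmon invgM /=.
have -> : \prod_(t < r) (val x *m val y) (tnth u t).1 (tnth u t).2 =
   \sum_(p : iT r) \prod_(t < r) (val x (tnth u t).1 (p t) * val y (p t) (tnth u t).2).
  by rewrite -(bigA_distr_bigA (fun t k => val x (tnth u t).1 k * val y k (tnth u t).2));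
     apply: eq_bigr => t _; rewrite mxE.
have -> : \prod_(t < s) (invmx (val y) *m invmx (val x)) (tnth v t).1 (tnth v t).2 =
   \sum_(p : iT s) \prod_(t < s)
     (invmx (val y) (tnth v t).1 (p t) * invmx (val x) (p t) (tnth v t).2).
  by rewrite -(bigA_distr_bigA (fun t k => invmx (val y) (tnth v t).1 k * invmx (val x) k (tnth v t).2));
     apply: eq_bigr => t _; rewrite mxE.
rewrite big_distrlr pair_big /=; apply: eq_bigr => -[p q] _ /=.
rewrite !big_split /= [X in _ * X]mulrC mulrACA.
by congr (_ * _ * (_ * _)); apply: eq_bigr => t _; rewrite !tnth_mktuple.
Qed.

End Coordinates.

Section Translations.
Variables (K : fieldType) (n r s : nat).
Local Notation A := (ratcoord K n r s).
Implicit Types (f : A) (x y z : GL K n) (xi eta : 'Hom(A, K^o)).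

Lemma ratcoord_eqP f1 f2 : (forall x, f1 x = f2 x) -> f1 = f2.
Proof. by move=> f12; apply: val_inj; apply/funext. Qed.

Lemma ratcoordE k f1 f2 x : (k *: f1 + f2) x = k * f1 x + f2 x.
Proof. by []. Qed.

Lemma ratcoord_comb (J : Type) (l : seq J) (c : J -> K) (h : J -> A) x :
  (\sum_(j <- l) c j *: h j : A) x = \sum_(j <- l) c j * h j x.
Proof.
elim: l => [|j l IH]; first by rewrite !big_nil.
by rewrite !big_cons ratcoordE IH.
Qed.

Lemma comultP f : exists l : seq (A * A),
  forall x y, f (x * y)%g = \sum_(gh <- l) gh.1 x * gh.2 y.
Proof. exact: (ratP_comult (valP f)). Qed.

Fact rtrans_subproof y f : (fun x => f (x * y)%g) \in fspan_pred (@ratmon K n r s).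
Proof.
have [l lE] := comultP f.
suff -> : (fun x => f (x * y)%g) = val (\sum_(gh <- l) (gh.2 y : K) *: gh.1 : A).
  exact: valP.
apply/funext => x; rewrite lE -[RHS]/(fspan_val _ x) ratcoord_comb.
by apply: eq_bigr => gh _; rewrite mulrC.
Qed.
(* For a comultiplication f(xy) = \sum g(x) h(y):                             *)
(* rconv eta f = \sum eta(h) g and lconv xi f = \sum xi(g) h.                  *)
Definition rtrans y f : A := Sub (fun x => f (x * y)%g) (rtrans_subproof y f).

Fact ltrans_subproof x f : (fun y => f (x * y)%g) \in fspan_pred (@ratmon K n r s).
Proof.
have [l lE] := comultP f.
suff -> : (fun y => f (x * y)%g) = val (\sum_(gh <- l) (gh.1 x : K) *: gh.2 : A).
  exact: valP.
by apply/funext => y; rewrite lE -[RHS]/(fspan_val _ y) ratcoord_comb.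
Qed.
Definition ltrans x f : A := Sub (fun y => f (x * y)%g) (ltrans_subproof x f).

Lemma comult_rtrans f (l : seq (A * A)) :
  (forall x y, f (x * y)%g = \sum_(gh <- l) gh.1 x * gh.2 y) ->
  forall y, rtrans y f = \sum_(gh <- l) (gh.2 y : K) *: gh.1.
Proof.
move=> lE y; apply: ratcoord_eqP => x; rewrite /= lE ratcoord_comb.
by apply: eq_bigr => gh _; rewrite mulrC.
Qed.

Lemma comult_ltrans f (l : seq (A * A)) :
  (forall x y, f (x * y)%g = \sum_(gh <- l) gh.1 x * gh.2 y) ->
  forall x, ltrans x f = \sum_(gh <- l) (gh.1 x : K) *: gh.2.
Proof.
by move=> lE x; apply: ratcoord_eqP => y; rewrite /= lE ratcoord_comb.
Qed.

Fact rconv_subproof eta f :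
  (fun x => eta (ltrans x f)) \in fspan_pred (@ratmon K n r s).
Proof.
have [l lE] := comultP f.
suff -> : (fun x => eta (ltrans x f)) = val (\sum_(gh <- l) (eta gh.2 : K) *: gh.1 : A).
  exact: valP.
apply/funext => x; rewrite (comult_ltrans lE) -[RHS]/(fspan_val _ x).
rewrite ratcoord_comb linear_sum; apply: eq_bigr => gh _.
by rewrite linearZ mulrC.
Qed.
Definition rconv eta f : A := Sub (fun x => eta (ltrans x f)) (rconv_subproof eta f).

Fact lconv_subproof xi f :
  (fun y => xi (rtrans y f)) \in fspan_pred (@ratmon K n r s).
Proof.
have [l lE] := comultP f.
suff -> : (fun y => xi (rtrans y f)) = val (\sum_(gh <- l) (xi gh.1 : K) *: gh.2 : A).
  exact: valP.
apply/funext => y; rewrite (comult_rtrans lE) -[RHS]/(fspan_val _ y).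
rewrite ratcoord_comb linear_sum; apply: eq_bigr => gh _.
by rewrite linearZ mulrC.
Qed.
Definition lconv xi f : A := Sub (fun y => xi (rtrans y f)) (lconv_subproof xi f).

Fact ltrans_linear x : linear (ltrans x).
Proof. by move=> k f g; apply: ratcoord_eqP. Qed.
Fact rtrans_linear y : linear (rtrans y).
Proof. by move=> k f g; apply: ratcoord_eqP. Qed.
Fact rconv_linear eta : linear (rconv eta).
Proof.
by move=> k f g; apply: ratcoord_eqP => x; rewrite ratcoordE /= ltrans_linear linearP.
Qed.
Fact lconv_linear xi : linear (lconv xi).
Proof.
by move=> k f g; apply: ratcoord_eqP => x; rewrite ratcoordE /= rtrans_linear linearP.
Qed.
HB.instance Definition _ eta := GRing.isLinear.Build K A A _ (rconv eta) (rconv_linear eta).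
HB.instance Definition _ xi := GRing.isLinear.Build K A A _ (lconv xi) (lconv_linear xi).

Definition eval1 f : K^o := f 1%g.
Fact eval1_linear : linear eval1. Proof. by []. Qed.
HB.instance Definition _ := GRing.isLinear.Build K A K^o _ eval1 eval1_linear.

End Translations.

(* S(n,r,s); the product, dual to f(xy) = \sum g(x) h(y), is                   *)
(* (xi * eta)(f) = \sum xi(g) eta(h) (see ratschur_comultE), so evaluation at  *)
(* group elements is multiplicative.                                          *)
Definition ratschur (K : fieldType) n r s := 'Hom(ratcoord K n r s, K^o).
HB.instance Definition _ (K : fieldType) n r s := Vector.on (ratschur K n r s).

Section RationalSchurAlgebra.
Variables (K : fieldType) (n r s : nat).
Local Notation A := (ratcoord K n.+1 r s).
Local Notation ratschur := (ratschur K n.+1 r s).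

Implicit Types xi eta zeta : ratschur.

Definition ratschur_one : ratschur := linfun (@eval1 K n.+1 r s).
Definition ratschur_mul xi eta : ratschur := linfun (xi \o rconv eta).

Lemma ratschur_mulE xi eta f : ratschur_mul xi eta f = xi (rconv eta f).
Proof. by rewrite lfunE. Qed.

Lemma ratschur_comultE xi eta (f : A) (l : seq (A * A)) :
  (forall x y, f (x * y)%g = \sum_(gh <- l) gh.1 x * gh.2 y) ->
  ratschur_mul xi eta f = \sum_(gh <- l) xi gh.1 * eta gh.2.
Proof.
move=> lE; rewrite ratschur_mulE.
have -> : rconv eta f = \sum_(gh <- l) (eta gh.2 : K) *: gh.1.
  apply: ratcoord_eqP => x; rewrite /= (comult_ltrans lE) ratcoord_comb.
  by rewrite linear_sum; apply: eq_bigr => gh _; rewrite linearZ mulrC.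
by rewrite linear_sum; apply: eq_bigr => gh _; rewrite linearZ mulrC.
Qed.

Fact ratschur_mulA : associative ratschur_mul.
Proof.
move=> xi eta zeta; apply/lfunP => f; rewrite !ratschur_mulE; congr (xi _).
apply: ratcoord_eqP => x /=; rewrite ratschur_mulE; congr (eta _).
apply: ratcoord_eqP => y /=; congr (zeta _).
by apply: ratcoord_eqP => z /=; rewrite mulgA.
Qed.
Fact ratschur_mul1 : left_id ratschur_one ratschur_mul.
Proof.
move=> xi; apply/lfunP => f; rewrite ratschur_mulE lfunE /= /eval1 /=; congr (xi _).
by apply: ratcoord_eqP => x /=; rewrite mul1g.
Qed.
Fact ratschur_mulr1 : right_id ratschur_one ratschur_mul.
Proof.
move=> xi; apply/lfunP => f; rewrite ratschur_mulE; congr (xi _).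
by apply: ratcoord_eqP => x /=; rewrite lfunE /= /eval1 /= mulg1.
Qed.
Fact ratschur_mulDl : left_distributive ratschur_mul +%R.
Proof.
by move=> xi eta zeta; apply/lfunP => f; rewrite add_lfunE !ratschur_mulE add_lfunE.
Qed.
Fact ratschur_mulDr : right_distributive ratschur_mul +%R.
Proof.
move=> xi eta zeta; apply/lfunP => f; rewrite add_lfunE !ratschur_mulE -linearD.
by congr (xi _); apply: ratcoord_eqP => x /=; rewrite add_lfunE.
Qed.
Fact ratschur_one_neq0 : ratschur_one != 0.
Proof.
pose p0 : 'I_n.+1 * 'I_n.+1 := (ord0, ord0).
pose u : r.-tuple ('I_n.+1 * 'I_n.+1)%type := [tuple p0 | t < r].
pose v : s.-tuple ('I_n.+1 * 'I_n.+1)%type := [tuple p0 | t < s].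
pose f : A := Sub (wmon u v) (mem_wmon K u v).
apply/eqP => /(congr1 (fun xi : ratschur => xi f)); rewrite zero_lfunE lfunE /=.
rewrite /eval1 /= /wmon invg1 !big1 => [|t _|t _];
  by rewrite ?tnth_mktuple ?mxE ?mulr1 //; move/eqP; rewrite oner_eq0.
Qed.

HB.instance Definition _ := GRing.Zmodule_isNzRing.Build ratschur
  ratschur_mulA ratschur_mul1 ratschur_mulr1 ratschur_mulDl ratschur_mulDr
  ratschur_one_neq0.

Fact ratschur_scaleAl k xi eta : k *: (xi * eta) = (k *: xi) * eta.
Proof. by apply/lfunP => f; rewrite scale_lfunE !ratschur_mulE scale_lfunE. Qed.
Fact ratschur_scaleAr k xi eta : k *: (xi * eta) = xi * (k *: eta).
Proof.
apply/lfunP => f; rewrite scale_lfunE !ratschur_mulE -linearZ; congr (xi _).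
by apply: ratcoord_eqP => x /=; rewrite scale_lfunE.
Qed.
HB.instance Definition _ :=
  GRing.Lmodule_isLalgebra.Build K ratschur ratschur_scaleAl.
HB.instance Definition _ :=
  GRing.Lalgebra_isAlgebra.Build K ratschur ratschur_scaleAr.
HB.instance Definition _ := Algebra_isFalgebra.Build K ratschur.

End RationalSchurAlgebra.

(* A(n,d) = A(n,d,0): no d_ij occurs. *)
Definition polcoord K n d := ratcoord K n d 0.
Definition schur K n d := ratschur K n d 0.
HB.instance Definition _ K n d := Vector.on (polcoord K n d).
HB.instance Definition _ K n d := Vector.on (schur K n d).
HB.instance Definition _ K n d := Falgebra.on (schur K n.+1 d).

Section DetMul.
Variables (K : fieldType) (n r s : nat).

Lemma adj_ratP (i j : 'I_n.+1) :
  (fun x : GL K n.+1 => (\adj (val x)) i j) \in fspan_pred (@ratmon K n.+1 n 0).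
Proof.
pose w (sg : 'S_n) : n.-tuple ('I_n.+1 * 'I_n.+1)%type :=
  [tuple (lift j t, lift i (sg t)) | t < n].
pose m (sg : 'S_n) : ratcoord K n.+1 n 0 := Sub (wmon (w sg) [tuple]) (mem_wmon K _ _).
pose c (sg : 'S_n) : K := (-1) ^+ (j + i) * (-1) ^+ sg.
suff -> : (fun x : GL K n.+1 => (\adj (val x)) i j) = val (\sum_sg c sg *: m sg).
  exact: valP.
apply/funext => x; rewrite -[RHS]/(fspan_val _ x) ratcoord_comb mxE /cofactor.
rewrite /determinant mulr_sumr; apply: eq_bigr => sg _; rewrite /c -mulrA.
congr (_ * (_ * _)); rewrite /= /wmon big_ord0 mulr1; apply: eq_bigr => t _.
by rewrite tnth_mktuple !mxE.
Qed.

Fact detmul_subproof (f : ratcoord K n.+1 r s) :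
  (fun x : GL K n.+1 => \det (val x) ^+ s * f x)
    \in fspan_pred (@ratmon K n.+1 (r + n * s) 0).
Proof.
have SP := fspan_submod (@ratmon K n.+1 (r + n * s) 0).
case: f => f fP /=; elim/ratP_ind: f / fP => [|k f g P1 P2|u v].
- suff -> : (fun x : GL K n.+1 => \det (val x) ^+ s * (0 : GL K n.+1 -> K^o) x) = 0.
    by case: SP.
  by apply/funext => x; rewrite mulr0.
- suff -> : (fun x : GL K n.+1 => \det (val x) ^+ s * (k *: f + g) x) =
    k *: (fun x : GL K n.+1 => \det (val x) ^+ s * f x : K^o)
      + (fun x => \det (val x) ^+ s * g x) by case: SP => _; apply.
  apply/funext => x; rewrite -[LHS]/(\det (val x) ^+ s * (k * f x + g x)).
  by rewrite mulrDr mulrCA.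
have memE (P : {pred GL K n.+1 -> K^o}) g h : g = h -> g \in P -> h \in P.
  by move=> ->.
have wP : wmon u [tuple] \in fspan_pred (@ratmon K n.+1 r 0) by exact: mem_wmon.
have aP (v' : seq ('I_n.+1 * 'I_n.+1)) :
    (fun x : GL K n.+1 => \prod_(p <- v') (\adj (val x)) p.1 p.2)
      \in fspan_pred (@ratmon K n.+1 (n * size v') 0).
  elim: v' => [|p v' IH].
    rewrite muln0.
    suff -> : (fun x : GL K n.+1 => \prod_(p <- [::]) (\adj (val x)) p.1 p.2)
      = wmon [tuple] [tuple] by exact: mem_wmon.
    by apply/funext => x; rewrite big_nil /wmon !big_ord0 mulr1.
  have := ratP_mul (adj_ratP p.1 p.2) IH; rewrite -mulnS addn0 /=.
  by apply: memE; apply/funext => x; rewrite big_cons.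
have := ratP_mul wP (aP v); rewrite (size_tuple v).
apply: (memE (fspan_pred (@ratmon K n.+1 (r + n * s) 0))); apply/funext => x; rewrite /wmon big_ord0 mulr1.
rewrite mulrCA; congr (_ * _).
have -> : \det (val x) ^+ s = \prod_(t < s) \det (val x).
  by rewrite prodr_const card_ord.
rewrite -big_split big_tuple /=.
apply: eq_bigr => t _; rewrite /invmx (valP x) !mxE mulrA.
by rewrite mulfV ?mul1r // -unitfE -unitmxE (valP x).
Qed.

(* a |-> D^s a for GL_(n+1), hence degree r + n s. *)
Definition detmul (f : ratcoord K n.+1 r s) : polcoord K n.+1 (r + n * s) :=
  Sub (fun x : GL K n.+1 => \det (val x) ^+ s * f x) (detmul_subproof f).

Fact detmul_linear : linear detmul.
Proof.
move=> k f g; apply: ratcoord_eqP => x.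
rewrite -[LHS]/(\det (val x) ^+ s * (k * f x + g x)) mulrDr mulrCA.
by [].
Qed.
HB.instance Definition _ :=
  GRing.isLinear.Build K (ratcoord K n.+1 r s) (polcoord K n.+1 (r + n * s)) _
    detmul detmul_linear.

Definition schur_quot (xi : schur K n.+1 (r + n * s)) : ratschur K n.+1 r s :=
  linfun (xi \o detmul).

Lemma schur_quot1 : schur_quot 1 = 1.
Proof.
apply/lfunP => f; rewrite lfunE /= !lfunE /= /eval1 /=.
by rewrite det1 expr1n mul1r.
Qed.

Lemma schur_quotM xi eta : schur_quot (xi * eta) = schur_quot xi * schur_quot eta.
Proof.
apply/lfunP => f; rewrite lfunE /=; have [l lE] := comultP f.
have dE x y : detmul f (x * y)%g =
    \sum_(gh <- [seq (detmul gh.1, detmul gh.2) | gh <- l]) gh.1 x * gh.2 y.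
  rewrite big_map /= lE mulr_sumr det_mulmx exprMn.
  by apply: eq_bigr => gh _; rewrite mulrACA.
rewrite (ratschur_comultE _ _ lE) /= (ratschur_comultE _ _ dE) big_map.
by apply: eq_bigr => gh _; rewrite !lfunE.
Qed.

End DetMul.

Section DominantWeights.
Variables (n d : nat).

(* Lambda^+(n,d); the bound lam_i <= d is implied by the sum condition. *)
Record domwt := DomWt {
  domwt_val :> {ffun 'I_n -> 'I_d.+1};
  _ : [forall i : 'I_n, forall j : 'I_n, (i <= j)%N ==> (domwt_val j <= domwt_val i)%N]
      && (\sum_i domwt_val i == d)%N }.

HB.instance Definition _ := [isSub for domwt_val].
HB.instance Definition _ := [Finite of domwt by <:].

(* Equality of the full sums holds since both weights have sum d. *)
Definition dominates (kap mu : domwt) : bool :=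
  [forall k : 'I_n, (\sum_(i < n | i <= k) mu i <= \sum_(i < n | i <= k) kap i)%N].

Fact dominates_refl : reflexive dominates.
Proof. by move=> kap; apply/forallP. Qed.
Fact dominates_trans : transitive dominates.
Proof.
move=> mu kap nu /forallP h1 /forallP h2; apply/forallP => k.
exact: leq_trans (h2 k) (h1 k).
Qed.
Fact dominates_anti : antisymmetric dominates.
Proof.
move=> kap mu /andP [/forallP h1 /forallP h2]; apply: val_inj; apply/ffunP => k.
have E j : (\sum_(i < n | i <= j) kap i = \sum_(i < n | i <= j) mu i)%N.
  case: (ltnP j n) => jn.
    by apply/eqP; rewrite eqn_leq (h2 (Ordinal jn)) (h1 (Ordinal jn)).
  have jT (i : 'I_n) : (i <= j)%N = true by rewrite (leq_trans (ltnW (ltn_ord i)) jn).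
  rewrite (eq_bigl xpredT) // [RHS](eq_bigl xpredT) //.
  case: (kap) => u /= /andP [_ /eqP ->]; by case: (mu) => v /= /andP [_ /eqP ->].
have E' : (\sum_(i < n | i < k) kap i = \sum_(i < n | i < k) mu i)%N.
  case: (nat_of_ord k) => [|j]; last exact: E.
  by rewrite !big1.
apply: val_inj; have := E k; rewrite (bigD1 k) //= [RHS](bigD1 k) //=.
have lt_le (i : 'I_n) : (i <= k)%N && (i != k) = (i < k)%N by rewrite ltn_neqAle andbC.
by rewrite (eq_bigl _ _ lt_le) [in RHS](eq_bigl _ _ lt_le) E' => /addIn.
Qed.

(* Reverse dominance: kap <= mu iff kap dominates mu. *)
Fact revdom_display : Order.disp_t. Proof. exact: Order.Disp tt tt. Qed.

HB.instance Definition _ := Order.Le_isPOrder.Build revdom_display domwt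
  dominates_refl dominates_anti dominates_trans.

Lemma domwt_leE (kap mu : domwt) : (kap <= mu)%O = dominates kap mu.
Proof. by []. Qed.

End DominantWeights.

Definition Rplus n d (s : nat) (lam : domwt n d) : {set 'I_n} :=
  [set i | (s < lam i)%N].

(* The weights lam of GL_(n+1) with \sum_(i in R^+_lam) lam_i <= r + |R^+_lam| s, *)
(* under the order inherited from domwt.                                      *)
Definition ratwt n r s :=
  {lam : domwt n.+1 (r + n * s) |
    (\sum_(i in Rplus s lam) lam i <= r + #|Rplus s lam| * s)%N}.
HB.instance Definition _ n r s := SubFinite.on (ratwt n r s).
HB.instance Definition _ n r s :=
  [SubChoice_isSubPOrder of ratwt n r s by <: with revdom_display].

Lemma ratwt_leE n r s (kap mu : ratwt n r s) :
  (kap <= mu)%O = dominates (val kap) (val mu).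
Proof. by []. Qed.


(* The Weyl module V(lam) = H^0(-w_0 lam)^*. With B the upper triangular        *)
(* matrices, H^0(-w_0 lam) is induced from the character -lam of B, i.e. it is *)
(* { f | f(xb) = lam(b) f(x) } with g acting by (g.f)(x) = f(g^-1 x); for lam  *)
(* in Lambda^+(n,d) these f lie in A(n,d). On the dual, g.phi maps f to         *)
(* phi(x |-> f(gx)), which weyl_act extends to S(n,d).                         *)
Section Weyl.
Variables (K : fieldType) (n d : nat) (lam : domwt n.+1 d).
Local Notation A := (polcoord K n.+1 d).
Implicit Types f : A.

Definition upper_tri (b : GL K n.+1) := is_trig_mx (val b)^T.

Definition semi_inv : {pred A} := fun f =>
  `[< forall x b, upper_tri b -> f (x * b)%g = (\prod_i val b i i ^+ lam i) * f x >].

Fact semi_inv_submod : submod_closed semi_inv.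
Proof.
split; first by apply/asboolP => x b _; rewrite mulr0.
move=> k f g /asboolP fP /asboolP gP; apply/asboolP => x b Ub.
by rewrite !ratcoordE fP // gP // mulrDr mulrCA.
Qed.

Definition ind_space : {vspace A} := sval (cid (vspace_of_submod semi_inv_submod)).

Lemma ind_spaceP f :
  reflect
    (forall x b, upper_tri b -> f (x * b)%g = (\prod_i val b i i ^+ lam i) * f x)
    (f \in ind_space).
Proof. by rewrite /ind_space; case: cid => U /= ->; apply: asboolP. Qed.

Lemma lconv_ind_space (xi : schur K n.+1 d) f :
  f \in ind_space -> lconv xi f \in ind_space.
Proof.
move=> /ind_spaceP fP; apply/ind_spaceP => x b Ub /=.
have -> : rtrans (x * b)%g f = (\prod_i val b i i ^+ lam i : K) *: rtrans x f.
  by apply: ratcoord_eqP => y /=; rewrite mulgA fP.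
by rewrite linearZ.
Qed.

Definition weyl := 'Hom(subvs_of ind_space, K^o).
HB.instance Definition _ := Vector.on weyl.

(* vsproj only retypes: lconv xi preserves ind_space, see weyl_actE. *)
Definition weyl_act (xi : schur K n.+1 d) (phi : weyl) : weyl :=
  linfun (phi \o vsproj ind_space \o lconv xi \o vsval).

Lemma weyl_actE xi phi (f : A) (fP : f \in ind_space) :
  weyl_act xi phi (Subvs fP) = phi (Subvs (lconv_ind_space xi fP)).
Proof.
rewrite lfunE /=; congr (phi _); apply: val_inj.
by rewrite /= vsprojK // lconv_ind_space.
Qed.

Lemma weyl_act1 phi : weyl_act 1 phi = phi.
Proof.
apply/lfunP => -[f fP]; rewrite weyl_actE; congr (phi _); apply: val_inj.
by apply: ratcoord_eqP => x /=; rewrite lfunE /= /eval1 /= mul1g.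
Qed.

Lemma weyl_actM xi eta phi : weyl_act (xi * eta) phi = weyl_act xi (weyl_act eta phi).
Proof.
apply/lfunP => -[f fP]; rewrite !weyl_actE; congr (phi _); apply: val_inj.
apply: ratcoord_eqP => y /=; have [l lE] := comultP (rtrans y f).
rewrite (ratschur_comultE _ _ lE).
have -> : rtrans y (lconv xi f) = \sum_(gh <- l) (xi gh.1 : K) *: gh.2.
  apply: ratcoord_eqP => z; rewrite ratcoord_comb /=.
  have -> : rtrans (z * y)%g f = \sum_(gh <- l) (gh.2 z : K) *: gh.1.
    apply: ratcoord_eqP => x; rewrite ratcoord_comb /= mulgA.
    by have /= -> := lE x z; apply: eq_bigr => gh _; rewrite mulrC.
  by rewrite linear_sum; apply: eq_bigr => gh _; rewrite linearZ mulrC.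
by rewrite linear_sum; apply: eq_bigr => gh _; rewrite linearZ.
Qed.

End Weyl.


Section Cellular.
Variables (K : fieldType) (A : falgType K).
Variables (disp : Order.disp_t) (L : finPOrderType disp).
Variables (M : L -> finType) (C : forall l, M l -> M l -> A).
Arguments C {l} : rename.

Definition cell_elt (p : {l : L & (M l * M l)%type}) : A :=
  C (tagged p).1 (tagged p).2.

Definition cell_below (l : L) : {vspace A} :=
  <<image cell_elt [pred p | (tag p < l)%O]>>%VS.

(* c S' S are coefficients r_a(S', S) in the cell l. *)
Definition cell_coef (l : L) (a : A) (c : M l -> M l -> K) : Prop :=
  forall S T, a * C S T - \sum_S' c S' S *: C S' T \in cell_below l.

Definition cellular_basis : Prop :=
  [/\ basis_of fullv (codom cell_elt),
      exists2 iota : {linear A -> A},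
        (forall x y, iota (x * y) = iota y * iota x)
        & (forall (l : L) (S T : M l), iota (C S T) = C T S)
    & forall l a, exists c : M l -> M l -> K, cell_coef a c].

(* The cell module at l, with basis M l and a S = \sum_S' r_a(S', S) S', is     *)
(* isomorphic to the left A-module (V, act); v S is the image of S.           *)
Definition cell_module_iso (l : L) (V : vectType K) (act : A -> V -> V) : Prop :=
  exists2 v : M l -> V, basis_of fullv (codom v)
    & forall a c, cell_coef a c -> forall S, act a (v S) = \sum_S' c S' S *: v S'.

End Cellular.

(* Main.v *)
From HB Require Import structures.
Require Import Defs.
From mathcomp Require Import all_boot all_order all_fingroup all_algebra all_field.
From mathcomp Require Import boolp functions.
From mathcomp Require Import zify.

Set Implicit Arguments.
Unset Strict Implicit.
Unset Printing Implicit Defensive.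

Import Order.TTheory GRing.Theory.

(** Write N = n + 1 and d = r + n s. The quotient map is dual to the embedding
    f |-> D^s f of A(N,r,s) into A(N,d), so its kernel I is the annihilator of
    D^s A(N,r,s), a two-sided ideal of S(N,d). Call lam admissible when it
    satisfies the condition on R^+_lam; in terms of excesses this says that
    \sum_i max(lam_i - s, 0) <= r ([admissibleE]). The excess sum is monotone
    for the dominance order, so inadmissible weights are closed upwards and
    their cells span a cell ideal J. The theorem amounts to I = J: the images
    of the other cells are then a basis, the anti-automorphism preserves I, and
    the multiplication rule passes to the quotient.

    J is contained in I. Let lam be inadmissible and let f = D^s g be a
    semi-invariant of weight lam with g in A(N,r,s). Restricted to the
    one-parameter torus acting with weight 1 on the columns in R^+_lam, the
    function g has degree at most r, whereas semi-invariance makes it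
    homogeneous of degree \sum_(i in R^+_lam) (lam_i - s) > r; hence f = 0
    ([detmul_semi_inv_eq0]). Dually I Delta(lam) = Delta(lam)
    ([weyl_act_ker_generates]). As the cell at lam is, modulo the cells above
    it, a sum of copies of Delta(lam), induction from the top of the dominance
    order puts it in I ([schur_quot_cell0]).

    Equality then follows from a lower bound for the dimension of A(N,r,s),
    namely the sum of the squares of dim Delta(lam) over admissible lam. A pair
    (T, T') of semistandard tableaux of shape lam gives a bideterminant, the
    product over the columns of the minors of x with rows T and columns T'.
    - All bideterminants are linearly independent ([bidet_independent]): on a
      product of two matrices of monomials in one variable their leading terms
      have distinct degrees.
    - When lam is admissible the bideterminant lies in D^s A(N,r,s)
      ([rat_bidet_div_det]): by the identity of Jacobi a minor of size h is D
      times a complementary minor of x^-1, of degree N - h, and this is applied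
      to the first s columns.
    - There are dim Delta(lam) semistandard tableaux of shape lam. When T' is
      the tableau whose row k is constantly k, the bideterminant is
      semi-invariant, so dim Delta(lam) is at least their number
      ([card_standard_le]). The squares of the dimensions add up to the
      dimension of A(N,d), hence to at most the number of monomials of degree
      d; and the Robinson-Schensted-Knuth correspondence injects monomials into
      pairs of tableaux of the same shape ([card_expo_le_tabpair]). So every
      inequality is an equality ([sum_sqr_le_dim_ratcoord]). *)

(** * The Robinson-Schensted-Knuth correspondence by local growth rules *)

(** Interlacing of two partitions: mu / lam is a horizontal strip. *)
Definition hstrip (lam mu : nat -> nat) :=
  forall k, lam k <= mu k /\ mu k.+1 <= lam k.

(** The local rule of the correspondence: it completes a square whose corners
    lam, mu, nu and whose content m are given. Each part is changed by a
    toggle, which is what makes the rule invertible. *)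
Definition growth_step (lam mu nu : nat -> nat) m k :=
  maxn (mu k) (nu k) + (if k is k'.+1 then minn (mu k') (nu k') - lam k' else m).

Lemma growth_step_hstrip lam mu nu m :
  hstrip lam mu -> hstrip lam nu ->
  hstrip mu (growth_step lam mu nu m) /\ hstrip nu (growth_step lam mu nu m).
Proof.
rewrite /growth_step => h1 h2; split.
  by case=> [|k]; [move: (h1 0) (h2 0) | move: (h1 k) (h2 k) (h1 k.+1) (h2 k.+1)]; lia.
by case=> [|k]; [move: (h1 0) (h2 0) | move: (h1 k) (h2 k) (h1 k.+1) (h2 k.+1)]; lia.
Qed.

(** The rule can be read backwards: part k + 1 of the new corner determines
    part k of lam, and part 0 determines m. *)
Lemma growth_step_inj lam mu nu m lam' mu' nu' m' :
  hstrip lam mu -> hstrip lam nu -> hstrip lam' mu' -> hstrip lam' nu' ->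
  mu =1 mu' -> nu =1 nu' -> growth_step lam mu nu m =1 growth_step lam' mu' nu' m' ->
  lam =1 lam' /\ m = m'.
Proof.
move=> h1 h2 h1' h2' Emu Enu E; split=> [k|].
  move: (E k.+1); rewrite /growth_step -!Emu -!Enu.
  by move: (h1 k) (h2 k) (h1' k) (h2' k); rewrite -!Emu -!Enu; lia.
by move: (E 0); rewrite /growth_step -!Emu -!Enu; lia.
Qed.

(** Since max + min is the sum, sizes are additive around a square. *)
Lemma growth_step_sum L lam mu nu m :
  hstrip lam mu -> hstrip lam nu -> mu L = 0 ->
  \sum_(k < L.+1) growth_step lam mu nu m k + \sum_(k < L.+1) lam k =
  m + \sum_(k < L.+1) mu k + \sum_(k < L.+1) nu k.
Proof.
move=> h1 h2 muL.
have lamL : lam L = 0 by have := h1 L; lia.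
rewrite big_ord_recl big_ord_recr /= lamL addn0 {1}/growth_step.
rewrite -addnA -big_split /=.
have -> : \sum_(i < L) (growth_step lam mu nu m (bump 0 i) + lam i) =
          \sum_(i < L) (maxn (mu i.+1) (nu i.+1) + minn (mu i) (nu i)).
  by apply: eq_bigr => i _; rewrite /growth_step /bump /= add1n add0n; move: (h1 i) (h2 i); lia.
rewrite big_split /= addnA.
have -> : maxn (mu 0) (nu 0) + m + \sum_(i < L) maxn (mu i.+1) (nu i.+1) =
          m + \sum_(k < L.+1) maxn (mu k) (nu k) by rewrite big_ord_recl addnA [m + _]addnC.
have -> : \sum_(i < L) minn (mu i) (nu i) = \sum_(i < L.+1) minn (mu i) (nu i).
  by rewrite big_ord_recr /= muL min0n addn0.
rewrite -!addnA -!big_split /=; congr (_ + _); apply: eq_bigr => i _; lia.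
Qed.

Section Growth.
Variable a : nat -> nat -> nat.

(** The partition attached to the corner (i, j) when the square with lower
    corner (i, j) has content a i j and the two axes carry empty partitions. *)
Fixpoint growth i : nat -> nat -> nat :=
  if i is i'.+1 then
    fix growth_row j := if j is j'.+1
      then growth_step (growth i' j') (growth_row j') (growth i' j) (a i' j')
      else fun=> 0
  else fun _ _ => 0.

Lemma growth0 i : growth i 0 =1 fun=> 0. Proof. by case: i. Qed.

Lemma growthS i j : growth i.+1 j.+1 =
  growth_step (growth i j) (growth i.+1 j) (growth i j.+1) (a i j).
Proof. by []. Qed.

Lemma growth_hstrip i j :
  hstrip (growth i j) (growth i.+1 j) /\ hstrip (growth i j) (growth i j.+1).
Proof.
elim: i j => [|i IH] j.
  split; last by [].
  elim: j => [|j IHj]; first by [].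
  have V : hstrip (growth 0 j) (growth 0 j.+1) by [].
  by rewrite growthS; have [] := growth_step_hstrip (a 0 j) IHj V.
suff V j' : hstrip (growth i.+1 j') (growth i.+1 j'.+1).
  split; last exact: V.
  elim: j => [|j IHj]; first by move=> k; rewrite !growth0.
  by have [] := growth_step_hstrip (a i.+1 j) IHj (V j).
by have [W V] := IH j'; have [] := growth_step_hstrip (a i j') W V.
Qed.

Lemma growth_eq0 i j k : j <= k -> growth i j k = 0.
Proof.
elim: j k => [|j IH] k; first by rewrite growth0.
case: k => // k /IH jk; have [_ /(_ k) []] := growth_hstrip i j; lia.
Qed.

Lemma growth_sum L i j : j <= L.+1 ->
  \sum_(k < L.+1) growth i j k = \sum_(i' < i) \sum_(j' < j) a i' j'.
Proof.
elim: i j => [|i IHi] j; first by rewrite big_ord0 big1.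
elim: j => [|j IHj] jL.
  rewrite big1 => [|k _]; last by rewrite growth0.
  by rewrite big1 // => i' _; rewrite big_ord0.
have [W V] := growth_hstrip i j.
have := growth_step_sum (a i j) W V (growth_eq0 i.+1 (jL : j <= L)).
rewrite -growthS (IHi j (ltnW jL)) (IHi _ jL) (IHj (ltnW jL)).
rewrite ![\sum_(i' < i.+1) _]big_ord_recr /= ![\sum_(j' < j.+1) a i _]big_ord_recr /=.
lia.
Qed.

End Growth.

(** The last row and the last column of the growth diagram are the two tableaux
    of the correspondence; the rest is recovered by moving towards the origin. *)
Lemma growth_inj N a a' :
  (forall j, j <= N -> growth a N j =1 growth a' N j) ->
  (forall i, i <= N -> growth a i N =1 growth a' i N) ->
  forall i j, i < N -> j < N -> a i j = a' i j.
Proof.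
move=> EN NE.
have step i j : growth a i.+1 j.+1 =1 growth a' i.+1 j.+1 ->
    growth a i.+1 j =1 growth a' i.+1 j -> growth a i j.+1 =1 growth a' i j.+1 ->
    growth a i j =1 growth a' i j /\ a i j = a' i j.
  move=> E1 E2 E3; have [W V] := growth_hstrip a i j.
  by have [W' V'] := growth_hstrip a' i j; apply: growth_step_inj W V W' V' E2 E3 E1.
have E p q : p <= N -> q <= N -> growth a (N - p) (N - q) =1 growth a' (N - p) (N - q).
  elim: p q => [|p IHp] q; first by move=> _ qN; rewrite subn0; apply: EN; lia.
  elim: q => [|q IHq] pN qN; first by rewrite subn0; apply: NE; lia.
  have ep : N - p = (N - p.+1).+1 by lia.
  have eq : N - q = (N - q.+1).+1 by lia.
  apply: (proj1 (step _ _ _ _ _)); rewrite -?ep -?eq.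
  - by apply: IHp; lia.
  - by apply: IHp; lia.
  - by apply: IHq; lia.
have E' i j : i <= N -> j <= N -> growth a i j =1 growth a' i j.
  by move=> iN jN; rewrite -[i](subKn iN) -[j](subKn jN); apply: E; lia.
by move=> i j iN jN; apply: (proj2 (step i j _ _ _)); apply: E'; lia.
Qed.

(** * Columns of a dominant weight *)
Section DomWtTheory.
Variables (n d : nat).
Implicit Types lam : domwt n d.

Lemma domwt_decr lam (i j : 'I_n) : i <= j -> lam j <= lam i.
Proof.
move=> ij; have /andP [/forallP /(_ i) /forallP /(_ j) /implyP H _] := valP lam.
exact: H.
Qed.

Lemma domwt_sum lam : \sum_i lam i = d.
Proof. by have /andP [_ /eqP] := valP lam. Qed.

(** Part c of the conjugate partition. *)
Definition height lam c := find (fun k => lam k <= c) (enum 'I_n).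

Lemma height_le lam c : height lam c <= n.
Proof. by rewrite -[X in _ <= X](size_enum_ord n) find_size. Qed.

Lemma ltn_height lam c (k : 'I_n) : (k < height lam c) = (c < lam k).
Proof.
apply/idP/idP => [kh|]; last apply: contraTT.
  by have := before_find k kh; rewrite nth_ord_enum ltnNge => ->.
rewrite -!leqNgt => hk; have hn := leq_ltn_trans hk (ltn_ord k).
have H : has (fun k => lam k <= c) (enum 'I_n) by rewrite has_find size_enum_ord.
have /= := nth_find k H; apply: leq_trans.
by apply: domwt_decr; rewrite -/(height lam c) nth_enum_ord.
Qed.

Lemma sum_height lam c (F : nat -> nat) :
  \sum_(a < height lam c) F a = \sum_(k < n | c < lam k) F k.
Proof.
rewrite (big_ord_widen_cond _ xpredT F (height_le lam c)) /=.
by apply: eq_bigl => k; rewrite ltn_height.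
Qed.

End DomWtTheory.

(** * Semistandard tableaux as chains of partitions *)
Section Tableaux.
Variables (n d : nat).
Local Notation N := n.+1.
Local Notation chain := {ffun 'I_n.+2 * 'I_n.+1 -> 'I_d.+1}.

Definition chain_val (P : chain) (j k : nat) : nat := P (inord j, inord k).

(** A semistandard tableau with entries in 'I_N is encoded by the shapes
    P 0, ..., P N of its subtableaux with entries < 0, ..., < N; consecutive
    shapes differ by a horizontal strip. This is the form in which a growth
    diagram produces tableaux. *)
Definition is_tableau (P : chain) :=
  [&& [forall k : 'I_N, chain_val P 0 k == 0],
      [forall j : 'I_N, forall k : 'I_N, (chain_val P j k <= chain_val P j.+1 k)
         && ((k.+1 < N) ==> (chain_val P j.+1 k.+1 <= chain_val P j k))]
    & \sum_(k < N) chain_val P N k == d].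

Definition tableau := {P : chain | is_tableau P}.
HB.instance Definition _ := SubFinite.on tableau.
Implicit Types t : tableau.

Definition tab_val t := chain_val (val t).

Lemma tab_val0 t k : k < N -> tab_val t 0 k = 0.
Proof.
by move=> kN; have /and3P [/forallP /(_ (Ordinal kN)) /eqP] := valP t.
Qed.

Lemma tab_val_leS t j k : j < N -> k < N -> tab_val t j k <= tab_val t j.+1 k.
Proof.
move=> jN kN; have /and3P [_ /forallP /(_ (Ordinal jN)) /forallP] := valP t.
by move=> /(_ (Ordinal kN)) /andP [].
Qed.

Lemma tab_val_strip t j k : j < N -> k.+1 < N -> tab_val t j.+1 k.+1 <= tab_val t j k.
Proof.
move=> jN kN; have /and3P [_ /forallP /(_ (Ordinal jN)) /forallP] := valP t.
by move=> /(_ (Ordinal (ltnW kN))) /andP [_ /implyP H] _; exact: (H kN).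
Qed.

Lemma tab_val_le t i j k : i <= j -> j <= N -> k < N -> tab_val t i k <= tab_val t j k.
Proof.
move=> ij jN kN; elim: j ij jN => [|j IH]; first by case: i.
rewrite leq_eqVlt => /predU1P [-> //|ij] jN.
exact: leq_trans (IH ij (ltnW jN)) (tab_val_leS _ _ _).
Qed.

Lemma tab_val_inj t t' :
  (forall j k, j <= N -> k < N -> tab_val t j k = tab_val t' j k) -> t = t'.
Proof.
move=> E; apply: val_inj; apply/ffunP => -[j k]; apply: val_inj.
have := E j k (ltn_ord j) (ltn_ord k).
by rewrite /tab_val /chain_val !inord_val.
Qed.

Lemma tableau_of (G : nat -> nat -> nat) :
  G 0 =1 (fun=> 0) -> (forall j, hstrip (G j) (G j.+1)) ->
  \sum_(k < N) G N k = d ->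
  exists t, forall j k, j <= N -> k < N -> tab_val t j k = G j k.
Proof.
move=> G0 GS Gd.
have Gle i j k : i <= j -> G i k <= G j k.
  by elim: j => [|j IH]; [case: i | rewrite leq_eqVlt => /predU1P [->//|/IH];
     have [H _] := GS j k; move=> /leq_trans; apply].
have GN j k : j <= N -> k < N -> G j k <= d.
  move=> jN kN; rewrite -Gd (bigD1 (Ordinal kN)) //=.
  by apply: leq_trans (leq_addr _ _); apply: Gle.
pose P : chain := [ffun p : 'I_n.+2 * 'I_N => inord (G p.1 p.2)].
have PE j k : j <= N -> k < N -> chain_val P j k = G j k.
  by move=> jN kN; rewrite /chain_val ffunE /= !inordK // ltnS GN.
have PP : is_tableau P.
  apply/and3P; split.
  - by apply/forallP => k; rewrite PE // G0.
  - apply/forallP => j; apply/forallP => k; have [H1 H2] := GS j k.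
    have jN := ltnW (ltn_ord j); rewrite (PE j k) // (PE j.+1 k) // H1 /=.
    by apply/implyP => kN; rewrite PE.
  - by rewrite -[X in _ == X]Gd; apply/eqP/eq_bigr => k _; rewrite PE.
by exists (Sub P PP).
Qed.

Lemma tab_val_decr t i j : i <= j -> j < N -> tab_val t N j <= tab_val t N i.
Proof.
elim: j => [|j IH]; first by case: i.
rewrite leq_eqVlt => /predU1P [-> //|ij] jN.
apply: leq_trans (IH ij (ltnW jN)); apply: leq_trans (tab_val_strip t (ltnSn n) jN) _.
exact: tab_val_leS (ltnSn n) (ltnW jN).
Qed.

Fact tab_shape_subproof t :
  let f := [ffun k : 'I_N => (val t) (ord_max, k)] in
  [forall i : 'I_N, forall j : 'I_N, (i <= j) ==> (f j <= f i)]
    && (\sum_i f i == d).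
Proof.
have E k : (val t) (ord_max, k) = tab_val t N k :> nat.
  rewrite /tab_val /chain_val inord_val.
  by have -> : inord N = ord_max :> 'I_N.+1 by apply: val_inj; rewrite /= inordK.
apply/andP; split.
  apply/forallP => i; apply/forallP => j; apply/implyP => ij.
  by rewrite !ffunE !E tab_val_decr.
have /and3P [_ _ /eqP dE] := valP t.
by apply/eqP; rewrite -[RHS]dE; apply: eq_bigr => k _; rewrite ffunE E.
Qed.
Definition tab_shape t : domwt n.+1 d := DomWt (tab_shape_subproof t).

Lemma tab_shapeE t (k : 'I_N) : tab_shape t k = tab_val t N k :> nat.
Proof.
rewrite ffunE /tab_val /chain_val inord_val.
by have -> : inord N = ord_max :> 'I_N.+1 by apply: val_inj; rewrite /= inordK.
Qed.

Definition tabpair := {q : tableau * tableau | tab_shape q.1 == tab_shape q.2}.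
HB.instance Definition _ := SubFinite.on tabpair.

(** An exponent matrix goes to the two borders of its growth diagram, which end
    in the same partition. *)
Lemma card_expo_le_tabpair : #|{: expo n.+1 d}| <= #|{: tabpair}|.
Proof.
(* Only the values with i, j < N matter: the default values of inord are never
   reached by the first N rows and columns of the diagram. *)
pose a (e : expo N d) (i j : nat) : nat := val e (inord i, inord j).
have ad e : \sum_(k < N) growth (a e) N N k = d.
  rewrite growth_sum // -[RHS](eqP (valP e)) pair_bigA /=.
  by apply: eq_bigr => -[i j] _; rewrite /a !inord_val.
have H (e : expo N d) : exists q : tabpair,
   (forall j k, j <= N -> k < N -> tab_val (val q).1 j k = growth (a e) N j k) /\
   (forall i k, i <= N -> k < N -> tab_val (val q).2 i k = growth (a e) i N k).
  have [||t tE] := @tableau_of (growth (a e) N) _ _ (ad e); first exact: growth0.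
    by move=> j; have [] := growth_hstrip (a e) N j.
  have [||t' t'E] := @tableau_of (fun i => growth (a e) i N) _ _ (ad e).
  - by [].
  - by move=> j; have [] := growth_hstrip (a e) j N.
  have st : tab_shape t == tab_shape t'.
    by apply/eqP/val_inj/ffunP => k; apply: val_inj;
      rewrite -[LHS]/(nat_of_ord (tab_shape t k)) -[RHS]/(nat_of_ord (tab_shape t' k));
      rewrite !tab_shapeE tE ?t'E.
  by exists (Sub (t, t') st).
pose f e := sval (cid (H e)).
apply: (@leq_card _ _ f) => e e' fe.
have [E1 E2] : (forall j k, j <= N -> k < N -> growth (a e) N j k = growth (a e') N j k) /\
   (forall j k, j <= N -> k < N -> growth (a e) j N k = growth (a e') j N k).
  move: fe; rewrite /f; case: cid => /= q [q1 q2]; case: cid => /= q' [q1' q2'] Eq.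
  by split=> j k jN kN; rewrite -?q1 -?q2 // Eq ?q1' ?q2'.
have E0 b i j k : N <= k -> i <= N -> j <= N -> growth b i j k = 0.
  by move=> Nk _ jN; rewrite growth_eq0 // (leq_trans jN).
have Ea i j : i < N -> j < N -> a e i j = a e' i j.
  apply: (@growth_inj N) => [j' jN k|i' iN k]; case: (ltnP k N) => kN.
  - exact: E1.
  - by rewrite !E0.
  - exact: E2.
  - by rewrite !E0.
apply: val_inj; apply/ffunP => -[i j]; apply: val_inj.
by have := Ea i j (ltn_ord i) (ltn_ord j); rewrite /a !inord_val.
Qed.

End Tableaux.

(** * Weights that single out leading terms *)
Section Digits.
Variable B : nat.

Lemma digits_lt M (a : nat -> nat) :
  (forall m, m < M -> a m < B) -> \sum_(m < M) a m * B ^ m < B ^ M.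
Proof.
elim: M => [|M IH] aB; first by rewrite big_ord0.
rewrite big_ord_recr /= expnS.
have := IH (fun m mM => aB m (ltnW mM)); have := aB M (ltnSn M).
set x := \sum_(_ < M) _; set y := B ^ M; nia.
Qed.

Lemma digits_inj M (a b : nat -> nat) :
  (forall m, m < M -> a m < B) -> (forall m, m < M -> b m < B) ->
  \sum_(m < M) a m * B ^ m = \sum_(m < M) b m * B ^ m ->
  forall m, m < M -> a m = b m.
Proof.
elim: M => [|M IH] aB bB; first by [].
have aB' m : m < M -> a m < B by move=> /ltnW; apply: aB.
have bB' m : m < M -> b m < B by move=> /ltnW; apply: bB.
rewrite !big_ord_recr /= => E.
have la := digits_lt aB'; have lb := digits_lt bB'.
have p0 : 0 < B ^ M by apply: leq_ltn_trans la.
have EM : a M = b M.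
  by have := congr1 (divn^~ (B ^ M)) E; rewrite !divnDr ?dvdn_mull //= !mulnK //
     !divn_small.
move=> m; rewrite ltnS leq_eqVlt => /predU1P [-> //|]; apply: IH => //.
by move: E; rewrite EM => /addIn.
Qed.

End Digits.

Lemma ltn_homo_inj h N (S : 'I_h -> 'I_N) :
  {homo S : a b / a < b} -> injective S.
Proof.
by move=> Sh a b E; case: (ltngtP a b) => [/Sh|/Sh|/val_inj //]; rewrite E ltnn.
Qed.

Section Weights.
Variables N B : nat.
Hypothesis NB : N < B.

(** The degree given to the variable in row i and column k. The exponent of B
    decreases lexicographically in (k, i), so the weights realise a diagonal
    term order: column 0 dominates, and inside a column the smallest row. *)
Definition cell_weight i k := B ^ ((N - k.+1) * N + (N - i.+1)).

Lemma cell_weight_lt i k i' k' : i < N -> k < N -> i' < N -> k' < N ->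
  (k < k') || (k == k') && (i < i') ->
  B * cell_weight i' k' <= cell_weight i k.
Proof.
move=> iN kN iN' kN' H; rewrite /cell_weight -expnS leq_exp2l; last by lia.
case/orP: H => [kk|/andP [/eqP <- ii]]; last by lia.
have : (N - k'.+1).+1 * N <= (N - k.+1) * N by rewrite leq_mul2r; apply/orP; right; lia.
rewrite mulSn; lia.
Qed.

(** The identity assignment is greedy: at the first index k where f differs
    from it, f gives to every row from k on a weight at least B times smaller
    than that of (S k, k), and there are at most N < B such rows. *)
Lemma cell_weight_max h (S f : 'I_h -> 'I_N) :
  {homo S : a b / a < b} -> injective f ->
  (forall a, f a = a :> nat) \/
  \sum_a cell_weight (S a) (f a) < \sum_a cell_weight (S a) a.
Proof.
move=> Shom finj.
have hN : h <= N by have := leq_card f finj; rewrite !card_ord.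
case: (pickP (fun a : 'I_h => f a != a :> nat)) => [a0 a0P|all]; last first.
  by left=> a; apply/eqP; move: (all a) => /negbFE.
right; pose k := [arg min_(a < a0 | f a != a :> nat) (a : nat)].
have [kP kmin] : f k != k :> nat /\ forall a : 'I_h, f a != a :> nat -> k <= a.
  by rewrite /k; case: arg_minnP.
have below (a : 'I_h) : a < k -> f a = a :> nat.
  by move=> ak; apply/eqP; apply: contraTT ak => /kmin; rewrite leqNgt.
have fge (a : 'I_h) : k <= a -> k <= f a.
  move=> ka; rewrite leqNgt; apply/negP => fk.
  have fh : f a < h by apply: ltn_trans fk _.
  have /val_inj/finj E : f (Ordinal fh) = f a :> nat by rewrite below.
  by move: ka; rewrite -E /= leqNgt fk.
have Sk (a : 'I_h) : k <= a -> S k <= S a.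
  by rewrite leq_eqVlt => /predU1P [/val_inj ->//|/Shom /ltnW].
rewrite (bigID (fun a : 'I_h => a < k)) [X in _ < X](bigID (fun a : 'I_h => a < k)) /=.
rewrite (eq_bigr (fun a : 'I_h => cell_weight (S a) a)); last first.
  by move=> a /below ->.
rewrite ltn_add2l; set L := (X in X < _).
have kw : B * L <= N * cell_weight (S k) k.
  apply: (@leq_trans (\sum_(a < h | ~~ (a < k)) cell_weight (S k) k)).
    rewrite big_distrr /=; apply: leq_sum => a; rewrite -leqNgt => ka.
    apply: cell_weight_lt => //; first exact: leq_trans (ltn_ord k) hN.
    have := fge a ka; rewrite leq_eqVlt => /predU1P [E|->//].
    rewrite -E eqxx /=; apply/orP; right; apply: Shom.
    rewrite ltn_neqAle ka andbT; apply: contra kP => /eqP /val_inj kE.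
    by rewrite -kE in E; rewrite -E.
  rewrite sum_nat_const leq_mul2r; apply/orP; right.
  by apply: leq_trans (max_card _) _; rewrite card_ord.
have kR : cell_weight (S k) k <= \sum_(a < h | ~~ (a < k)) cell_weight (S a) a.
  by rewrite (bigD1 k) ?ltnn //= leq_addr.
have w0 : 0 < cell_weight (S k) k by rewrite expn_gt0; lia.
apply: leq_trans kR; move: NB kw w0; clear; set w := cell_weight _ _; nia.
Qed.

End Weights.

Section LeadingTerm.
Local Open Scope ring_scope.

(** The Cauchy-Binet formula before the injective f are grouped by their images;
    the grouping is pointless when only the leading term matters. *)
Lemma det_mulmx_rect (R : comNzRingType) h N (A : 'M[R]_(h, N)) (B : 'M[R]_(N, h)) :
  \det (A *m B) =
  \sum_(f : {ffun 'I_h -> 'I_N}) (\prod_a A a (f a)) * \det (rowsub f B).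
Proof.
rewrite /determinant; under [RHS]eq_bigr => f _ do rewrite big_distrr /=.
rewrite exchange_big /=; apply: eq_bigr => s _.
under eq_bigr => a _ do rewrite mxE.
rewrite (bigA_distr_bigA (fun a k => A a k * B k (s a))) big_distrr /=.
apply: eq_bigr => f _; rewrite big_split /= mulrCA; congr (_ * (_ * _)).
by apply: eq_bigr => a _; rewrite !mxE.
Qed.

Variables (K : fieldType) (N B : nat).
Hypothesis NB : (N < B)%N.
Local Notation u := (cell_weight N B).

(** A factor above every total weight of a tableau, so that the contributions of
    row and column tableaux can be read off separately. *)
Definition pair_base := (B ^ (N * N))%N.

Definition monomial_product_mx : 'M[{poly K}]_N :=
  (\matrix_(i < N, k < N) 'X^(u i k)) *m (\matrix_(k < N, j < N) 'X^(pair_base * u j k)).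

Definition minor_deg h (S T : 'I_h -> 'I_N) :=
  (\sum_a u (S a) a + pair_base * \sum_a u (T a) a)%N.

(** Expanding both the product and the determinants, the terms are indexed by an
    injection f and a permutation s; by [cell_weight_max] for S and f and for T
    and f \o s^-1, the maximal degree is reached only when both are trivial. *)
Lemma size_minor_monomial_product h (S T : 'I_h -> 'I_N) :
  {homo S : a b / (a < b)%N} -> {homo T : a b / (a < b)%N} ->
  (size (\det (mxsub S T monomial_product_mx) - 'X^(minor_deg S T))%R <= minor_deg S T)%N.
Proof.
move=> Sh Th.
have Sinj := ltn_homo_inj Sh.
have hN : (h <= N)%N by have := leq_card S Sinj; rewrite !card_ord.
set D := minor_deg S T.
have -> : mxsub S T monomial_product_mx =
    (\matrix_(a < h, k < N) 'X^(u (S a) k)) *m (\matrix_(k < N, b < h) 'X^(pair_base * u (T b) k)).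
  by apply/matrixP => a b; rewrite !mxE; apply: eq_bigr => k _; rewrite !mxE.
pose E (p : {ffun 'I_h -> 'I_N} * 'S_h) :=
  (\sum_a u (S a) (p.1 a) + pair_base * \sum_a u (T (p.2 a)) (p.1 a))%N.
rewrite det_mulmx_rect (bigID (fun f : {ffun 'I_h -> 'I_N} => injectiveb f)) /= addrC -addrA.
rewrite big1 ?add0r => [|f finj]; last first.
  have [a [b [ab fab]]] : exists a b, a != b /\ f a = f b.
    apply/not_existsP => H; case/negP: finj; apply/injectiveP => a b fab.
    apply/eqP; apply: contraT => ab; case: (H a); by exists b.
  rewrite (determinant_alternate ab) ?mulr0 // => b'; by rewrite !mxE fab.
have -> : \sum_(f : {ffun 'I_h -> 'I_N} | injectiveb f)
      (\prod_a (\matrix_(a < h, k < N) 'X^(u (S a) k)) a (f a)) *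
        \det (rowsub f (\matrix_(k < N, b < h) 'X^(pair_base * u (T b) k))) =
    \sum_(p : {ffun 'I_h -> 'I_N} * 'S_h | injectiveb p.1) (-1) ^+ p.2 * 'X^(E p) :> {poly K}.
  transitivity (\sum_(f : {ffun 'I_h -> 'I_N} | injectiveb f)
      \sum_(s : 'S_h) (-1) ^+ s * 'X^(E (f, s)) : {poly K}); last first.
    by rewrite pair_big /=; apply: eq_big => [[f s]|[f s] _] //=; rewrite andbT.
  apply: eq_bigr => f _; rewrite /determinant big_distrr /=; apply: eq_bigr => s _.
  rewrite mulrCA; congr (_ * _); rewrite /E /= exprD.
  congr (_ * _).
    by rewrite -prodrXr; apply: eq_bigr => a _; rewrite mxE.
  by rewrite big_distrr -prodrXr; apply: eq_bigr => a _; rewrite !mxE.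
pose f0 : {ffun 'I_h -> 'I_N} := [ffun a => widen_ord hN a].
have f0inj : injectiveb f0.
  by apply/injectiveP => a b; rewrite !ffunE => /(congr1 val) /= /val_inj.
rewrite (bigD1 (f0, 1%g)) //= odd_perm1 mul1r.
have -> : E (f0, 1%g) = D.
  rewrite /E /D /minor_deg /=; congr (_ + _ * _)%N;
  by apply: eq_bigr => a _; rewrite ffunE ?perm1.
rewrite addrAC subrr add0r.
elim/big_rec: _ => [|[f s] p /andP [/= /injectiveP finj neq] IH]; first by rewrite size_poly0.
apply: leq_trans (size_polyD _ _) _; rewrite geq_max IH andbT.
have Esf : E (f, s) =
    (\sum_a u (S a) (f a) + pair_base * \sum_a u (T a) (f (s^-1 a)%g))%N.
  rewrite /E /=; congr (_ + _ * _)%N.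
  by rewrite [RHS](reindex_inj (@perm_inj _ s)) /=; apply: eq_bigr => a _; rewrite permK.
suff ltE : (E (f, s) < D)%N.
  by rewrite mulr_sign; case: ifP => _; rewrite ?size_polyN size_polyXn.
have fsinj : injective (fun a => f (s^-1 a)%g) by move=> a b /finj /perm_inj.
have Q0 : (0 < pair_base)%N by rewrite expn_gt0; lia.
rewrite Esf /D /minor_deg.
have [fid|lt1] := cell_weight_max NB Sh finj; last first.
  rewrite -addSn leq_add // leq_mul2l; apply/orP; right.
  have [fsid|/ltnW //] := cell_weight_max NB Th fsinj.
  by apply/eq_leq/eq_bigr => a _; rewrite fsid.
have [fsid|lt2] := cell_weight_max NB Th fsinj; last first.
  rewrite -addnS leq_add ?ltn_pmul2l //.
  by apply/eq_leq/eq_bigr => a _; rewrite fid.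
case/negP: neq; apply/eqP; congr (_, _).
  by apply/ffunP => a; apply: val_inj; rewrite ffunE; exact: fid.
by apply/permP => a; rewrite perm1; apply: val_inj; rewrite -[LHS]fsid /= permK; exact: fid.
Qed.
End LeadingTerm.

(** * Bideterminants and their linear independence *)
Section Bideterminants.
Variables (n d : nat).
Local Notation N := n.+1.
Local Notation tab := (tableau n d).
Implicit Types (t : tab) (l : domwt n.+1 d).

(** The entry in row k and column c is the index of the step at which the cell
    (k, c) enters the chain. *)
Definition entry t c k : 'I_N :=
  inord (find (fun j => c < tab_val t j.+1 k) (iota 0 N)).

Lemma entryP t c k : k < N -> c < tab_val t N k ->
  tab_val t (entry t c k) k <= c < tab_val t (entry t c k).+1 k.
Proof.
move=> kN ck; set p := (fun j => c < tab_val t j.+1 k).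
have H : has p (iota 0 N) by apply/hasP; exists n; rewrite ?mem_iota //= ltnSn.
have fN : find p (iota 0 N) < N by move: H; rewrite has_find size_iota.
rewrite /entry -/p inordK //.
have ci : c < tab_val t (find p (iota 0 N)).+1 k.
  by have := nth_find 0 H; rewrite nth_iota.
rewrite ci andbT; case E : (find p _) => [|i]; first by rewrite tab_val0.
have iN : i < N by move: fN; rewrite E; exact: ltnW.
have := @before_find _ 0 p (iota 0 N) i; rewrite E ltnSn => /(_ isT).
by rewrite nth_iota // add0n /p ltnNge => /negbFE.
Qed.

Lemma entry_eq t c k j : k < N -> j < N ->
  tab_val t j k <= c -> c < tab_val t j.+1 k -> entry t c k = j :> nat.
Proof.
move=> kN jN jc cj.
have cN : c < tab_val t N k by apply: leq_trans cj _; exact: tab_val_le.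
have /andP [ec ce] := entryP kN cN.
apply/eqP; rewrite eqn_leq; apply/andP; split; rewrite leqNgt; apply/negP => lt.
  have := leq_trans cj (tab_val_le t lt (ltnW (ltn_ord _)) kN).
  by rewrite ltnNge ec.
have := leq_trans ce (tab_val_le t lt (ltnW jN) kN).
by rewrite ltnNge jc.
Qed.

Lemma entry_lt t c k k' : k < k' -> k' < N -> c < tab_val t N k' ->
  entry t c k < entry t c k'.
Proof.
elim: k' => // k' IH; rewrite ltnS leq_eqVlt => kk kN ck'.
have ck : c < tab_val t N k'.
  apply: leq_trans ck' _; exact: tab_val_decr.
suff lt : entry t c k' < entry t c k'.+1.
  case/predU1P: kk => [-> //|kk]; apply: ltn_trans lt; exact: IH (ltnW kN) ck.
have /andP [_ ce] := entryP kN ck'; have /andP [ec _] := entryP (ltnW kN) ck.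
rewrite ltnNge; apply/negP => le.
have := leq_trans ce (tab_val_strip t (ltn_ord _) kN).
rewrite ltnNge; case/negP.
apply: leq_trans ec; apply: tab_val_le => //; [exact: ltnW|exact: ltnW].
Qed.

(** In row k the value i occurs in the columns from t i k to t i.+1 k. *)
Lemma sum_entry t k (G : nat -> nat) j : k < N -> j <= N ->
  \sum_(0 <= c < tab_val t j k) G (entry t c k) =
  \sum_(i < j) (tab_val t i.+1 k - tab_val t i k) * G i.
Proof.
move=> kN; elim: j => [|j IH] jN.
  by rewrite tab_val0 // big_geq // big_ord0.
rewrite big_ord_recr /= -IH; last exact: ltnW.
rewrite (big_cat_nat _ (tab_val_leS t jN kN)) //=; congr (_ + _).
rewrite -sum_nat_const_nat; apply: eq_big_nat => c /andP [c1 c2].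
by rewrite (entry_eq kN jN).
Qed.

Definition column l t c (a : 'I_(height l c)) : 'I_N := entry t c a.

Lemma column_homo l t c : tab_shape t = l -> {homo @column l t c : a b / a < b}.
Proof.
move=> <- {l} a b ab; have bN := leq_trans (ltn_ord b) (height_le _ c).
apply: entry_lt => //.
have : c < tab_shape t (Ordinal bN) by rewrite -ltn_height /=.
by rewrite tab_shapeE.
Qed.

Let B := (N + d.+1)%N.
Let NB : N < B. Proof. by rewrite /B; lia. Qed.
Local Notation u := (cell_weight N B).

Definition tab_weight t := \sum_(k < N) \sum_(i < N) (tab_val t i.+1 k - tab_val t i k) * u i k.

Lemma sum_column_weight l t m : tab_shape t = l -> d <= m ->
  \sum_(c < m) \sum_(a < height l c) u (column t a) a = tab_weight t.
Proof.
move=> tl dm; rewrite /tab_weight.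
have E (c : 'I_m) : \sum_(a < height l c) u (@column l t c a) a =
    \sum_(k < N | c < l k) u (entry t c k) k.
  exact: (sum_height l c (fun k => u (entry t c k) k)).
rewrite (eq_bigr _ (fun c _ => E c)) (exchange_big_dep xpredT) //=.
apply: eq_bigr => k _; rewrite -(@sum_entry _ _ (fun i => u i k)) // big_mkord -tab_shapeE tl.
have lm : l k <= m by apply: leq_trans dm; rewrite -ltnS.
by rewrite (big_ord_widen m (fun c => u (entry t c k) k) lm).
Qed.

(** The multiplicities of the entries in the rows are the digits of the total
    weight in base B, and they determine the tableau. Rows and entries are
    reversed because the cell weight decreases in both. *)
Definition tab_digit t k i :=
  tab_val t (N - i.+1).+1 (N - k.+1) - tab_val t (N - i.+1) (N - k.+1).
Definition tab_row_number t k := \sum_(i < N) tab_digit t k i * B ^ i.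

Lemma tab_weightE t :
  tab_weight t = \sum_(k < N) tab_row_number t k * (B ^ N) ^ k.
Proof.
rewrite /tab_weight (reindex_inj rev_ord_inj); apply: eq_bigr => k _.
rewrite (reindex_inj rev_ord_inj) big_distrl; apply: eq_bigr => i _ /=.
rewrite /cell_weight -mulnA; congr (_ * _).
have e (j : nat) : j < N -> N - (N - j.+1).+1 = j by lia.
by rewrite !e // expnD mulnC -expnM [N * k]mulnC.
Qed.

Lemma tab_digit_lt t k i : tab_digit t k i < B.
Proof.
apply: leq_ltn_trans (leq_subr _ _) _; rewrite /B.
have lt : tab_val t (N - i.+1).+1 (N - k.+1) < d.+1 by exact: ltn_ord.
exact: leq_trans lt (leq_addl _ _).
Qed.

Lemma tab_row_number_lt t k : tab_row_number t k < B ^ N.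
Proof. by apply: digits_lt => i _; apply: tab_digit_lt. Qed.

Lemma tab_weight_lt t : tab_weight t < B ^ (N * N).
Proof.
by rewrite tab_weightE expnM; apply: digits_lt => k _; apply: tab_row_number_lt.
Qed.

Lemma tab_weight_inj : injective tab_weight.
Proof.
move=> t t'; rewrite !tab_weightE => E.
have H1 := digits_inj (fun k _ => tab_row_number_lt t k)
  (fun k _ => tab_row_number_lt t' k) E.
have H2 i k : i < N -> k < N ->
    tab_val t i.+1 k - tab_val t i k = tab_val t' i.+1 k - tab_val t' i k.
  move=> iN kN; have kN' : N - k.+1 < N by lia.
  have iN' : N - i.+1 < N by lia.
  have e (j : nat) : j < N -> N - (N - j.+1).+1 = j by lia.
  have := digits_inj (fun i _ => tab_digit_lt t _ i) (fun i _ => tab_digit_lt t' _ i)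
     (H1 _ kN') iN'.
  by rewrite /tab_digit !e.
apply: tab_val_inj; elim=> [|j IH] k jN kN; first by rewrite !tab_val0.
have := H2 j k jN kN; have := IH k (ltnW jN) kN.
by have := tab_val_leS t jN kN; have := tab_val_leS t' jN kN; lia.
Qed.

Local Open Scope ring_scope.

(** Columns c >= l 0 are empty and contribute 1, so every number m >= d of
    factors gives the same function; this freedom lets the first s columns be
    split off even when s exceeds their number. *)
Definition bidet (R : comNzRingType) l m t t' (x : 'M[R]_N) : R :=
  \prod_(c < m) \det (mxsub (@column l t c) (@column l t' c) x).

Definition pair_weight (q : tabpair n d) : nat :=
  (tab_weight (val q).1 + B ^ (N * N) * tab_weight (val q).2)%N.

Lemma pair_weight_inj : injective pair_weight.
Proof.
move=> q q'; rewrite /pair_weight => E; apply: val_inj.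
have b0 : (0 < B ^ (N * N))%N by apply: leq_ltn_trans (tab_weight_lt (val q).1).
have := congr1 (modn^~ (B ^ (N * N))%N) E; have := congr1 (divn^~ (B ^ (N * N))%N) E.
rewrite /= !(mulnC (B ^ _)%N) !(addnC (tab_weight _)) !divnMDl // !modnMDl.
rewrite !(divn_small (tab_weight_lt _)) !(modn_small (tab_weight_lt _)) !addn0.
move=> /tab_weight_inj E2 /tab_weight_inj E1.
by move: E1 E2; case: (val q) => a b; case: (val q') => a' b' /= -> ->.
Qed.

Section Independence.
Variable K : closedFieldType.

Definition generic_mx : 'M[{poly K}]_N := monomial_product_mx K N B.

Lemma monic_minor_generic h (S T : 'I_h -> 'I_N) :
  {homo S : a b / (a < b)%N} -> {homo T : a b / (a < b)%N} ->
  \det (mxsub S T generic_mx) \is monic /\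
  size (\det (mxsub S T generic_mx)) = (minor_deg B S T).+1.
Proof.
move=> Sh Th; have := size_minor_monomial_product K NB Sh Th.
rewrite -/generic_mx; set p : {poly K} := \det _; set D := minor_deg _ _ _ => sp.
have -> : p = 'X^D + (p - 'X^D) by rewrite addrC subrK.
have lt : (size (p - 'X^D)%R < size ('X^D : {poly K}))%N by rewrite size_polyXn.
split; last by rewrite size_polyDl // size_polyXn.
by rewrite monicE lead_coefDl // lead_coefXn.
Qed.

Lemma monic_bidet_generic (q : tabpair n d) m : (d <= m)%N ->
  let p := bidet (tab_shape (val q).1) m (val q).1 (val q).2 generic_mx in
  p \is monic /\ size p = (pair_weight q).+1.
Proof.
move=> dm; case: q => -[t t'] qP /=; have /= /eqP tt' := qP; rewrite /pair_weight /=.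
set l := tab_shape t.
have H (c : 'I_m) := monic_minor_generic (@column_homo l t c erefl) (@column_homo l t' c (esym tt')).
split; first by apply: monic_prod => c _; case: (H c).
rewrite /bidet size_prod; last by move=> c _; apply: monic_neq0; case: (H c).
rewrite (eq_bigr (fun c : 'I_m => (minor_deg B (@column l t c) (@column l t' c)).+1)); last first.
  by move=> c _; case: (H c).
rewrite -(sum_column_weight (erefl l) dm) -(sum_column_weight (esym tt' : tab_shape t' = l) dm).
rewrite big_distrr -big_split /=.
rewrite (eq_bigr (fun c : 'I_m => minor_deg B (@column l t c) (@column l t' c) + 1)%N); last first.
  by move=> c _; rewrite addn1.
by rewrite big_split /= sum1_card subSn ?leq_addl // addnK.
Qed.

Lemma generic_mx_unit : \det generic_mx != 0.
Proof.
have H : {homo (@id 'I_N) : a b / (a < b)%N} by [].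
have [/monic_neq0] := monic_minor_generic H H.
by have -> : mxsub id id generic_mx = generic_mx by apply/matrixP => i j; rewrite mxE.
Qed.

Lemma bidet_horner l m t t' (x : 'M[{poly K}]_N) z :
  (bidet l m t t' x).[z] = bidet l m t t' (map_mx (horner_eval z) x).
Proof.
rewrite -[LHS]/(horner_eval z _) rmorph_prod; apply: eq_bigr => c _.
by rewrite -det_map_mx; congr (\det _); apply/matrixP => i j; rewrite !mxE.
Qed.

(** The generic matrix is invertible for all but finitely many values of
    the variable, so a relation on GL_N becomes one between polynomials whose
    degrees are pairwise distinct. *)
Lemma bidet_independent m (c : tabpair n d -> K) : (d <= m)%N ->
  (forall x : 'M[K]_N, x \in unitmx ->
     \sum_q c q * bidet (tab_shape (val q).1) m (val q).1 (val q).2 x = 0) ->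
  forall q, c q = 0.
Proof.
move=> dm H q0; apply/eqP; apply: contraT => cq0.
pose P (q : tabpair n d) : {poly K} := bidet (tab_shape (val q).1) m (val q).1 (val q).2 generic_mx.
pose R : {poly K} := \sum_q c q *: P q.
have R0 : R = 0.
  apply/eqP; have : R * \det generic_mx == 0.
    apply: contraT => /closed_nonrootP [z]; rewrite /root hornerM mulf_eq0 negb_or.
    case/andP => Rz dz; case/negP: Rz.
    have Uz : map_mx (horner_eval z) generic_mx \in unitmx.
      by rewrite unitmxE det_map_mx unitfE.
    rewrite /R horner_sum -[X in _ == X](H _ Uz); apply/eqP/eq_bigr => q _.
    by rewrite hornerZ bidet_horner.
  by rewrite mulf_eq0 (negbTE generic_mx_unit) orbF.
(* The coefficient of R at the largest weight present is that of a single term. *)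
pose q1 := [arg max_(q > q0 | c q != 0) pair_weight q].
have [cq1 q1max] : c q1 != 0 /\ forall q, c q != 0 -> (pair_weight q <= pair_weight q1)%N.
  by rewrite /q1; case: arg_maxnP.
have := congr1 (fun p : {poly K} => p`_(pair_weight q1)) R0.
rewrite /R coef_sum coef0 (bigD1 q1) //= big1 ?addr0 => [|q qq1]; last first.
  rewrite coefZ; have [->|/q1max] := eqVneq (c q) 0; first by rewrite mul0r.
  rewrite leq_eqVlt => /predU1P [/pair_weight_inj E|lt]; first by rewrite E eqxx in qq1.
  by rewrite nth_default ?mulr0 //; have [_ ->] := monic_bidet_generic q dm.
have [/monicP + sz] := monic_bidet_generic q1 dm.
rewrite coefZ /lead_coef sz /= => -> /eqP.
by rewrite mulr1 (negbTE cq1).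
Qed.

End Independence.
End Bideterminants.

Local Open Scope ring_scope.

(** * Which functions lie in A(N,r,s) *)
Section Membership.
Variables (K : fieldType) (n : nat).
Local Notation N := n.+1.
Local Notation ratP r s := (fspan_pred (@ratmon K N r s)).
Implicit Types (x : GL K N) (f g : GL K N -> K^o).

Lemma rat_ext r s f g : (forall x, f x = g x) -> f \in ratP r s -> g \in ratP r s.
Proof. by move=> /funext ->. Qed.

Lemma rat_const (k : K) : (fun=> k) \in ratP 0 0.
Proof.
apply: (@rat_ext _ _ (k *: wmon [tuple] [tuple])).
  by move=> x; rewrite -[LHS]/(k * _) /wmon !big_ord0 !mulr1.
by apply: rpredZ; apply: mem_wmon.
Qed.

Lemma rat_entry i j : (fun x => val x i j) \in ratP 1 0.
Proof.
apply: (@rat_ext _ _ (wmon [tuple (i, j)] [tuple])); last exact: mem_wmon.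
by move=> x; rewrite /wmon big_ord0 big_ord_recl big_ord0 !mulr1.
Qed.

Lemma rat_inv_entry i j : (fun x => val (x^-1)%g i j) \in ratP 0 1.
Proof.
apply: (@rat_ext _ _ (wmon [tuple] [tuple (i, j)])); last exact: mem_wmon.
by move=> x; rewrite /wmon big_ord0 big_ord_recl big_ord0 mulr1 mul1r.
Qed.

Lemma rat_prod m (f : 'I_m -> GL K N -> K^o) (a b : 'I_m -> nat) :
  (forall i, f i \in ratP (a i) (b i)) ->
  (fun x => \prod_i f i x) \in ratP (\sum_i a i)%N (\sum_i b i)%N.
Proof.
elim: m f a b => [|m IH] f a b H.
  rewrite !big_ord0; apply: rat_ext (rat_const 1) => x.
  by rewrite big_ord0.
rewrite !big_ord_recl.
apply: rat_ext (ratP_mul (H ord0) (IH _ _ _ (fun i => H (lift ord0 i)))) => x.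
by rewrite big_ord_recl.
Qed.

Lemma rat_det m (W : GL K N -> 'M[K]_m) (a b : 'I_m -> nat) :
  (forall i j, (fun x => W x i j) \in ratP (a j) (b j)) ->
  (fun x => \det (W x)) \in ratP (\sum_i a i)%N (\sum_i b i)%N.
Proof.
move=> H.
have E : (fun x => \det (W x)) =
    \sum_(s : 'S_m) ((-1) ^+ s : K) *: (fun x => \prod_j W x (s j) j : K^o).
  apply/funext => x; rewrite -det_tr /determinant fct_sumE.
  apply: eq_bigr => s _; rewrite -[RHS]/(_ * _); congr (_ * _).
  by apply: eq_bigr => j _; rewrite mxE.
rewrite E; apply: rpred_sum => s _; apply: rpredZ.
by apply: rat_prod => j; apply: H.
Qed.

(** The constant 1 is \sum_k c_0k d_k0, an element of A(N,1,1). *)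
Lemma rat_shift r s t f : f \in ratP r s -> f \in ratP (r + t) (s + t).
Proof.
move=> fP; elim: t => [|t IH]; first by rewrite !addn0.
have one : (fun=> 1) \in ratP 1 1.
  apply: (@rat_ext _ _ (\sum_k (fun x => val x ord0 k * val (x^-1)%g k ord0))).
    move=> x; rewrite fct_sumE.
    have := congr1 (fun A : 'M[K]_N => A ord0 ord0) (mulmxV (valP x)).
    by rewrite mxE [RHS]mxE eqxx mulr1n => <-.
  by apply: rpred_sum => k _; apply: (ratP_mul (rat_entry _ _) (rat_inv_entry _ _)).
have := ratP_mul IH one; rewrite -!addnA !addn1.
by apply: rat_ext => x; rewrite mulr1.
Qed.

Lemma rat_minor h (S T : 'I_h -> 'I_N) :
  (fun x => \det (mxsub S T (val x))) \in ratP h 0.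
Proof.
have := @rat_det h (fun x => mxsub S T (val x)) (fun=> 1%N) (fun=> 0%N).
rewrite !sum_nat_const card_ord muln1 muln0; apply=> i j.
by apply: rat_ext (rat_entry (S i) (T j)) => x; rewrite mxE.
Qed.

End Membership.

Lemma det_unit_columns (R : comNzRingType) h N (hN : (h <= N)%N) (M : 'M[R]_N) :
  (forall k l : 'I_N, (h <= l)%N -> M k l = (k == l)%:R) ->
  \det M = \det (mxsub (widen_ord hN) (widen_ord hN) M).
Proof.
have [m Nm] : exists m, N = (h + m)%N by exists (N - h)%N; rewrite subnKC.
subst N => H.
have -> : M = block_mx (ulsubmx M) 0 (dlsubmx M) 1%:M.
  rewrite -[LHS]submxK; congr block_mx; apply/matrixP => i j; rewrite !mxE H ?leq_addr //.
    by rewrite -val_eqE /= ltn_eqF // (leq_trans (ltn_ord i)) // leq_addr.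
  by rewrite -!val_eqE /= eqn_add2l.
rewrite det_lblock det1 mulr1; congr (\det _); apply/matrixP => i j.
have w (a : 'I_h) : widen_ord hN a = lshift m a by apply: val_inj.
by rewrite [RHS]mxE !w block_mxEul.
Qed.

Lemma perm_extend h N (hN : (h <= N)%N) (S : 'I_h -> 'I_N) : injective S ->
  exists s : 'S_N, forall a, s (widen_ord hN a) = S a.
Proof.
move=> Sinj; pose C := [predC codom S]; pose L := codom S ++ enum C.
have sL : size L = N.
  apply: etrans (card_ord N); rewrite -(cardC (mem (codom S))).
  by rewrite size_cat -cardE size_codom card_codom.
have uL : uniq L.
  rewrite cat_uniq enum_uniq andbT; apply/andP; split.
    by rewrite map_inj_uniq // enum_uniq.
  by apply/hasPn => i; rewrite mem_enum.
have fi : injective (fun k : 'I_N => nth k L k).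
  move=> i j /eqP; rewrite (set_nth_default j) ?sL //.
  by rewrite nth_uniq ?sL // => /eqP /val_inj.
exists (perm fi) => a; rewrite permE nth_cat size_codom card_ord /= ltn_ord.
by rewrite (nth_map a) ?size_enum_ord // nth_ord_enum.
Qed.

Section Jacobi.
Variables (K : fieldType) (n : nat).
Local Notation N := n.+1.
Local Notation ratP r s := (fspan_pred (@ratmon K N r s)).
Implicit Types (x : GL K N).

(** Jacobi: extend S and T to permutations s and t, and let Z have the columns
    t l of x for l < h and the unit columns s l for l >= h. Then det Z is the
    minor up to sign, and x^-1 Z has unit columns for l < h and columns of x^-1
    for l >= h, so det x^-1 det Z has degree N - h in x^-1. *)
Lemma rat_minor_div_det h (S T : 'I_h -> 'I_N) : (h <= N)%N ->
  injective S -> injective T ->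
  (fun x => (\det (val x))^-1 * \det (mxsub S T (val x))) \in ratP 0 (N - h).
Proof.
move=> hN /(perm_extend hN) [s sE] /(perm_extend hN) [t tE].
pose Z x : 'M[K]_N := \matrix_(i, l) if (l < h)%N then val x i (t l) else (i == s l)%:R.
pose Y x : 'M[K]_N :=
  \matrix_(i, l) if (l < h)%N then (i == t l)%:R else val (x^-1)%g i (s l).
have ZS x : \det (mxsub S T (val x)) = (-1) ^+ s * \det (Z x).
  rewrite -det_perm -det_mulmx -row_permE (det_unit_columns hN) => [|k l hl].
    by congr (\det _); apply/matrixP => a b; rewrite !mxE /= ltn_ord sE tE.
  by rewrite !mxE ltnNge hl (inj_eq (@perm_inj _ s)).
have YZ x : val (x^-1)%g *m Z x = Y x.
  apply/matrixP => i l; rewrite !mxE.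
  have E := mulVmx (valP x); case: ifP => lh.
    rewrite -[RHS](_ : (1%:M : 'M[K]_N) i (t l) = _); last by rewrite mxE.
    by rewrite -E mxE; apply: eq_bigr => j _; rewrite !mxE lh.
  rewrite (bigD1 (s l)) //= big1 ?addr0 => [|j js]; rewrite !mxE lh.
    by rewrite eqxx mulr1.
  by rewrite (negbTE js) mulr0.
have E x : (-1) ^+ s * \det (Y x) = (\det (val x))^-1 * \det (mxsub S T (val x)).
  by rewrite ZS -YZ det_mulmx /= det_inv mulrCA.
apply: (rat_ext E).
rewrite -[fun x => _]/((-1 : K) ^+ s *: (fun x => \det (Y x) : K^o)); apply: rpredZ.
have := @rat_det K n N Y (fun=> 0%N) (fun l => nat_of_bool (h <= l)%N).
have -> : (\sum_(i < N) nat_of_bool (h <= i) = N - h)%N.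
  rewrite -(big_mkord xpredT (fun i => nat_of_bool (h <= i)%N)) (big_cat_nat _ hN) //=.
  rewrite big_nat_cond big1 => [|i /andP [/andP [_ ih] _]]; last by rewrite leqNgt ih.
  rewrite add0n (eq_big_nat _ _ (F2 := fun=> 1%N)) => [|i /andP [-> //]].
  by rewrite sum_nat_const_nat muln1.
rewrite sum_nat_const muln0; apply=> i l; rewrite leqNgt; case lh : (l < h)%N => /=.
  by apply: rat_ext (rat_const n _) => x; rewrite mxE lh.
by apply: rat_ext (rat_inv_entry K _ _) => x; rewrite mxE lh.
Qed.

End Jacobi.

Section HeightSums.
Variables (n d : nat) (l : domwt n d).

Lemma sum_ltn m a : (\sum_(c < m) (c < a) = minn m a)%N.
Proof. by elim: m => [|m IH]; rewrite ?big_ord0 ?big_ord_recr /= ?IH; lia. Qed.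

Lemma heightE c : height l c = (\sum_(k < n) (c < l k))%N.
Proof.
rewrite -[LHS]card_ord -sum1_card (sum_height l c (fun=> 1%N)) big_mkcond.
by apply: eq_bigr => k _; case: ltnP.
Qed.

Lemma sum_height_minn m : (\sum_(c < m) height l c = \sum_(k < n) minn m (l k))%N.
Proof.
under eq_bigr => c _ do rewrite heightE.
by rewrite exchange_big; apply: eq_bigr => k _; rewrite -sum_ltn.
Qed.

Lemma sum_height_all m : (d <= m)%N -> (\sum_(c < m) height l c = d)%N.
Proof.
move=> dm; rewrite sum_height_minn -[RHS](domwt_sum l); apply: eq_bigr => k _.
by apply/minn_idPr; apply: leq_trans dm; rewrite -ltnS.
Qed.

Lemma sum_height_tail s :
  (\sum_(c < d) height l (s + c)%N = \sum_(k < n) (l k - s))%N.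
Proof.
under eq_bigr => c _ do rewrite heightE.
rewrite exchange_big; apply: eq_bigr => k _ /=.
rewrite (eq_bigr (fun c : 'I_d => (c < l k - s)%N : nat)) => [|c _]; last first.
  by congr nat_of_bool; lia.
by rewrite sum_ltn; apply/minn_idPr; have := ltn_ord (l k); lia.
Qed.

(** Only the indices in R^+ have positive excess over s. *)
Lemma sum_Rplus s :
  (\sum_(k in Rplus s l) l k = \sum_(k < n) (l k - s) + #|Rplus s l| * s)%N.
Proof.
rewrite -sum_nat_const [in RHS](bigID (mem (Rplus s l))) /=.
rewrite [X in (_ + X + _)%N]big1 => [|k]; last by rewrite inE; lia.
by rewrite addn0 -big_split; apply: eq_bigr => k; rewrite inE /=; lia.
Qed.

End HeightSums.

Section BidetFunctions.
Variables (K : fieldType) (n d : nat).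
Local Notation N := n.+1.
Local Notation ratP r s := (fspan_pred (@ratmon K N r s)).
Implicit Types (t : tableau n d) (l : domwt N d) (x : GL K N).

Lemma column_inj l t c : tab_shape t = l -> injective (@column n d l t c).
Proof. by move=> tl; apply: ltn_homo_inj; apply: column_homo. Qed.

Lemma rat_bidet l t t' m : (d <= m)%N ->
  (fun x => bidet l m t t' (val x)) \in ratP d 0.
Proof.
move=> dm.
have := @rat_prod K n m (fun c x => \det (mxsub (@column _ _ l t c) (@column _ _ l t' c) (val x)))
  (fun c => height l c) (fun=> 0%N) (fun c => rat_minor K _ _).
by rewrite sum_height_all // sum_nat_const muln0.
Qed.

(** The first s columns absorb D^-s and have total degree
    r'' = \sum_(c < s) (N - height l c) in x^-1; the other columns have total
    degree r' = \sum_k (l k - s). Since r - r' = s - r'', the two degrees can be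
    raised to r and s simultaneously. *)
Lemma rat_bidet_div_det l t t' r s : tab_shape t = l -> tab_shape t' = l ->
  (d + s = r + N * s)%N -> (\sum_k (l k - s) <= r)%N ->
  (fun x => (\det (val x)) ^- s * bidet l (s + d) t t' (val x)) \in ratP r s.
Proof.
move=> tl tl' dE lr.
have H1 := @rat_prod K n s
  (fun c x => (\det (val x))^-1 * \det (mxsub (@column _ _ l t c) (@column _ _ l t' c) (val x)))
  (fun=> 0%N) (fun c => N - height l c)%N
  (fun c => rat_minor_div_det K (height_le l c) (column_inj tl) (column_inj tl')).
have H2 := @rat_prod K n d
  (fun c x => \det (mxsub (@column _ _ l t (s + c)) (@column _ _ l t' (s + c)) (val x)))
  (fun c => height l (s + c)) (fun=> 0%N) (fun c => rat_minor K _ _).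
have := ratP_mul H1 H2.
rewrite sum_height_tail !sum_nat_const !muln0 add0n addn0.
set r' := (\sum_(k < N) _)%N.
have E1 : (\sum_(c < s) (N - height l c) + \sum_(k < N) minn s (l k) = N * s)%N.
  rewrite -sum_height_minn -big_split /= (eq_bigr (fun=> N)) => [|c _].
    by rewrite sum_nat_const card_ord mulnC.
  by rewrite subnK // height_le.
have E2 : (r' + \sum_(k < N) minn s (l k) = d)%N.
  by rewrite -[RHS](domwt_sum l) -big_split /=; apply: eq_bigr => k _; lia.
move=> /(@rat_shift _ _ _ _ (r - r')); rewrite subnKC //.
have -> : (\sum_(c < s) (N - height l c) + (r - r') = s)%N by move: lr; rewrite -/r'; lia.
apply: rat_ext => x; rewrite /bidet big_split_ord big_split /= mulrA.
by rewrite prodr_const card_ord exprVn.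
Qed.

End BidetFunctions.

(** * Semi-invariant bideterminants *)
Section Canonical.
Variables (n d : nat).
Local Notation N := n.+1.
Implicit Types (l : domwt N d).

(** Row k is filled with k: in the chain, part k appears at step k + 1 and stays
    constant. *)
Lemma canonical_tableau l : exists t, tab_shape t = l /\
  forall c (a : 'I_(height l c)), column t a = a :> nat.
Proof.
pose w k := if insub k is Some k' then l k' : nat else 0%N.
have wE (k : 'I_N) : w k = l k by rewrite /w valK.
have w_decr k : (w k.+1 <= w k)%N.
  case: (ltnP k.+1 N) => kN; last by rewrite /w insubN // -leqNgt.
  have := wE (Ordinal kN); have := wE (Ordinal (ltnW kN)) => /= -> ->.
  exact: domwt_decr.
pose G j k := if (k < j)%N then w k else 0%N.
have [|||t tE] := @tableau_of n d G _ _ _.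
- by [].
- move=> j k; rewrite /G; split; first by case: (ltnP k j) => // kj; rewrite ltnS (ltnW kj).
  by rewrite ltnS; case: (ltnP k j).
- rewrite -[RHS](domwt_sum l); apply: eq_bigr => k _.
  by rewrite /G ltn_ord wE.
have tl : tab_shape t = l.
  by apply/val_inj/ffunP => k; apply: ord_inj; rewrite [LHS]tab_shapeE tE // /G ltn_ord wE.
exists t; split=> // c a.
have aN := leq_trans (ltn_ord a) (height_le l c).
apply: entry_eq => //; first by rewrite tE ?(ltnW aN) // /G ltnn.
have : (Ordinal aN < height l c)%N by exact: (ltn_ord a).
by rewrite ltn_height -wE tE // /G ltnSn.
Qed.

Variable K : fieldType.

(** The columns of t0 select initial segments, which are stable under upper
    triangular b; each minor is thus multiplied by a leading principal minor of
    b, a product of diagonal entries. *)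
Lemma bidet_mul_upper l m t t0 (x b : 'M[K]_N) : (d <= m)%N ->
  (forall c (a : 'I_(height l c)), column t0 a = a :> nat) ->
  (forall i j : 'I_N, (j < i)%N -> b i j = 0) ->
  bidet l m t t0 (x *m b) = (\prod_k b k k ^+ l k) * bidet l m t t0 x.
Proof.
move=> dm t0E bU.
have -> : \prod_k b k k ^+ l k =
    \prod_(c < m) \prod_(a < height l c) b (widen_ord (height_le l c) a) (widen_ord (height_le l c) a).
  under [RHS]eq_bigr => c _ do
    rewrite -(@big_ord_narrow _ _ _ _ _ (fun k : 'I_N => b k k) (height_le l c)).
  rewrite (exchange_big_dep xpredT) //=; apply: eq_bigr => k _.
  have lm : (l k <= m)%N by apply: leq_trans dm; rewrite -ltnS.
  rewrite -[X in _ ^+ X]card_ord -prodr_const (big_ord_widen m (fun=> b k k) lm).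
  by apply: eq_bigl => c; rewrite ltn_height.
rewrite /bidet -big_split /=; apply: eq_bigr => c _.
set h := height l c; set w := widen_ord (height_le l c).
have wE (a : 'I_h) : column t0 a = w a by apply: ord_inj; rewrite t0E.
have -> : mxsub (@column _ _ l t c) (@column _ _ l t0 c) (x *m b) =
    mxsub (@column _ _ l t c) (@column _ _ l t0 c) x *m mxsub w w b.
  apply/matrixP => a e; rewrite !mxE wE (bigID (fun j : 'I_N => (j < h)%N)) /=.
  rewrite [X in _ + X]big1 ?addr0 => [|j]; last first.
    by rewrite -leqNgt => hj; rewrite bU ?mulr0 //= (leq_trans (ltn_ord e)).
  rewrite (big_ord_narrow (height_le l c)); apply: eq_bigr => j _.
  by rewrite !mxE wE.
rewrite det_mulmx mulrC -[\det (mxsub w w b)]det_tr det_trig.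
  by congr (_ * _); apply: eq_bigr => a _; rewrite !mxE.
by apply/is_trig_mxP => i j ij; rewrite !mxE bU.
Qed.

End Canonical.

(** * Counting dimensions *)
Section Dimensions.
Variable (K : fieldType).

Lemma dim_ge_indep (V : vectType K) (U : {vspace V}) (I : finType) (b : I -> V) :
  (forall i, b i \in U) ->
  (forall c : I -> K, \sum_i c i *: b i = 0 -> forall i, c i = 0) -> (#|I| <= \dim U)%N.
Proof.
move=> bU ind; pose X := [tuple b (enum_val k) | k < #|I|].
have fX : free X.
  apply/freeP => k k0 i; rewrite -(enum_valK i).
  apply: (ind (fun j => k (enum_rank j))); rewrite -[RHS]k0.
  rewrite (reindex (@enum_val I I)) /=; last exact: onW_bij (@enum_val_bij I).
  by apply: eq_bigr => j _; rewrite enum_valK nth_mktuple.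
have := eqP fX; rewrite size_tuple => <-; apply: dimvS; apply/span_subvP => v.
by case/tnthP => j ->; rewrite tnth_mktuple.
Qed.

Lemma dim_fspan_le (X : Type) (I : finType) (b : I -> X -> K^o) :
  (\dim {:fspan b} <= #|I|)%N.
Proof.
pose e i : fspan b := FSpan (mem_fspan b i).
apply: (@leq_trans (\dim <<codom e>>)); last by rewrite -(size_codom e) dim_span.
apply: dimvS; apply/subvP => -[f fP] _; have /fspanP [c fE] := fP.
have -> : FSpan fP = \sum_i (c i : K) *: e i.
  apply: val_inj; rewrite /= fE; apply: (big_ind2 (fun g (h : fspan b) => g = val h)) => //.
  by move=> g1 h1 g2 h2 -> ->.
by apply: rpred_sum => i _; apply: rpredZ; apply/memv_span/codom_f.
Qed.

Lemma dim_basis_codom (V : vectType K) (I : finType) (b : I -> V) :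
  basis_of fullv (codom b) -> \dim {:V} = #|I|.
Proof. by case/andP => /eqP <- /eqP ->; rewrite size_codom. Qed.

Lemma dim_dual (V : vectType K) : \dim {:'Hom(V, K^o)} = \dim {:V}.
Proof. by rewrite !dimvf /dim /= muln1. Qed.

End Dimensions.

Section Counting.
Variables (n d : nat).
Local Notation N := n.+1.

Lemma card_tabpair :
  #|{: tabpair n d}| = (\sum_(l : domwt N d) #|[pred t | tab_shape t == l]| ^ 2)%N.
Proof.
rewrite card_sig -sum1_card (partition_big (fun q : tableau n d * tableau n d => tab_shape q.1) xpredT) //=.
apply: eq_bigr => l _; rewrite sum1_card -mulnn -cardX; apply: eq_card => -[t t'].
rewrite !inE /= -[LHS]/((tab_shape t == tab_shape t') && (tab_shape t == l)).
case: (tab_shape t =P l) => [->|_]; last by rewrite andbF.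
by rewrite andbT eq_sym.
Qed.

Lemma card_pairs_in (I : finType) (M : I -> finType) :
  #|{: {i : I & (M i * M i)%type}}| = (\sum_i #|M i| ^ 2)%N.
Proof.
rewrite card_tagged sumnE big_map big_enum /=.
by apply: eq_bigr => i _; rewrite card_prod mulnn.
Qed.

Lemma card_expo0 : (#|{: expo N 0}| <= 1)%N.
Proof.
apply/card_le1_eqP => a b _ _; apply: val_inj; apply/ffunP => p.
by rewrite [LHS]ord1 [RHS]ord1.
Qed.

End Counting.

Local Notation admissible r s l :=
  (\sum_(i in Rplus s l) l i <= r + #|Rplus s l| * s)%N.

Section DimensionBounds.
Variables (K : closedFieldType) (n d : nat).
Local Notation N := n.+1.
Local Notation standard l := {t : tableau n d | tab_shape t == l}.

Lemma bidet_independent_sub (I : finType) (phi : I -> tabpair n d) m (c : I -> K) :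
  injective phi -> (d <= m)%N ->
  (forall x : 'M[K]_N, x \in unitmx ->
     \sum_i c i * bidet (tab_shape (val (phi i)).1) m (val (phi i)).1 (val (phi i)).2 x = 0) ->
  forall i, c i = 0.
Proof.
move=> phi_inj dm H i0; pose c' q := \sum_(i | phi i == q) c i.
have c'E i : c' (phi i) = c i.
  by rewrite /c' (eq_bigl (pred1 i)) ?big_pred1_eq // => j; rewrite /= (inj_eq phi_inj).
rewrite -c'E; apply: (bidet_independent dm) => x /H xE; rewrite -[RHS]xE.
rewrite [RHS](partition_big phi xpredT) //=; apply: eq_bigr => q _.
by rewrite /c' big_distrl /=; apply: eq_bigr => i /eqP <-.
Qed.

Lemma card_standard_le l : (#|{: standard l}| <= \dim (ind_space K l))%N.
Proof.
have [t0 [t0l t0E]] := canonical_tableau l.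
pose b (t : standard l) : polcoord K N d :=
  FSpan (rat_bidet K l (val t) t0 (leqnn d)).
apply: (@dim_ge_indep _ _ _ _ b) => [t|c c0].
  apply/ind_spaceP => x u /is_trig_mxP uU /=.
  rewrite (@bidet_mul_upper _ _ _ l) // => i j ji.
  by have := uU j i ji; rewrite mxE.
have pP (t : standard l) : tab_shape (val t, t0).1 == tab_shape (val t, t0).2.
  by rewrite /= t0l; exact: (valP t).
pose phi (t : standard l) : tabpair n d := Sub (val t, t0) (pP t).
apply: (@bidet_independent_sub _ phi d) => // [t t' E|x xU].
  by apply: val_inj; exact: (congr1 (fun q : tabpair n d => (val q).1) E).
have := congr1 (fun f : polcoord K N d => f (Sub x xU : GL K N)) c0.
rewrite ratcoord_comb => c0x; rewrite -[RHS]c0x; apply: eq_bigr => t _ /=.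
by congr (_ * bidet _ _ _ _ _); apply/eqP/(valP t).
Qed.

End DimensionBounds.

Section RatDimension.
Variables (K : closedFieldType) (n r s : nat).
Local Notation N := n.+1.
Local Notation d := (r + n * s)%N.
Local Notation standard l := {t : tableau n d | tab_shape t == l}.

Lemma admissibleE (l : domwt N d) : admissible r s l = (\sum_i (l i - s) <= r)%N.
Proof. by rewrite sum_Rplus leq_add2r. Qed.

Lemma dim_ratcoord_ge :
  (\sum_(l : domwt N d | admissible r s l) #|{: standard l}| ^ 2 <= \dim {:ratcoord K N r s})%N.
Proof.
pose I := {q : tabpair n d | admissible r s (tab_shape (val q).1)}.
have -> : (\sum_(l : domwt N d | admissible r s l) #|{: standard l}| ^ 2 = #|{: I}|)%N.
  rewrite card_sig -sum1_card.
  rewrite (partition_big (fun q : tabpair n d => tab_shape (val q).1) (fun l => admissible r s l)) //=.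
  apply: eq_bigr => l lP; rewrite card_sig -mulnn -cardX -[LHS]sum1_card.
  rewrite (reindex_omap (fun q : tabpair n d => val q) insub) /=; last first.
    by move=> [t t']; rewrite !inE /= => /andP [/eqP t1 /eqP t2]; rewrite insubT //= t1 t2.
  apply: eq_bigl => q; rewrite valK eqxx andbT inE /= [RHS]andbC.
  have /eqP E := valP q; rewrite !inE -E andbb.
  by case: eqP => //= El; symmetry; move: lP; rewrite -El.
have dE : (d + s = r + N * s)%N by rewrite mulSn -addnA [(_ + s)%N]addnC.
have mem (q : I) := rat_bidet_div_det K (erefl _)
  (esym (eqP (valP (val q))) : tab_shape (val (val q)).2 = tab_shape (val (val q)).1) dE
  (etrans (esym (admissibleE _)) (valP q)).
pose b (q : I) : ratcoord K N r s := FSpan (mem q).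
apply: (@dim_ge_indep _ _ _ _ b) => [q|c c0]; first exact: memvf.
apply: (@bidet_independent_sub K n d I (fun q => val q) (s + d)) => //.
  exact: leq_addl.
move=> x xU.
have := congr1 (fun f : ratcoord K N r s => \det x ^+ s * f (Sub x xU : GL K N)) c0.
rewrite ratcoord_comb /= mulr0 => c0x; rewrite -[RHS]c0x big_distrr.
apply: eq_bigr => q _; rewrite /= mulrCA; congr (_ * _).
by rewrite mulrA mulfV ?mul1r // expf_neq0 // -unitfE -unitmxE.
Qed.

(** The numbers g l of tableaux satisfy g l <= M l, while the sum of the M l ^ 2
    is at most that of the g l ^ 2; so g and M agree, and the bound
    [dim_ratcoord_ge] applies to M. *)
Lemma sum_sqr_le_dim_ratcoord (M : domwt N d -> nat) :
  (forall l, M l = \dim (ind_space K l)) ->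
  (\sum_l M l ^ 2 = \dim {:polcoord K N d})%N ->
  (\sum_(l : ratwt n r s) M (val l) ^ 2 <= \dim {:ratcoord K N r s})%N.
Proof.
move=> Mdim Msum; apply: leq_trans dim_ratcoord_ge.
have gM l : (#|{: standard l}| <= M l)%N by rewrite Mdim card_standard_le.
have le_sum : (\sum_l M l ^ 2 <= \sum_(l : domwt N d) #|{: standard l}| ^ 2)%N.
  rewrite Msum; apply: leq_trans (dim_fspan_le _) _; rewrite card_prod.
  apply: leq_trans (leq_mul (card_expo_le_tabpair n d) (card_expo0 n)) _.
  by rewrite muln1 card_tabpair; apply/eq_leq/eq_bigr => l _; rewrite card_sig.
have gE l : (#|{: standard l}| = M l)%N.
  apply/eqP; rewrite eqn_leq gM leqNgt; apply/negP => lt.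
  move: le_sum; rewrite leqNgt; case/negP.
  rewrite (bigD1 l) //= [X in (_ < X)%N](bigD1 l) //= -addSn leq_add //.
    by rewrite ltn_sqr.
  by apply: leq_sum => k _; rewrite leq_sqr.
under [X in (_ <= X)%N]eq_bigr do rewrite gE.
rewrite [X in (_ <= X)%N](reindex_omap (val : ratwt n r s -> _) insub) /=; last first.
  by move=> l lP; rewrite insubT.
by apply/eq_leq/eq_bigl => l; rewrite valK eqxx andbT; symmetry; apply: (valP l).
Qed.

End RatDimension.

(** * A degree bound along a one-parameter torus *)
Section Torus.
Variables (K : fieldType) (n : nat) (P : {set 'I_n.+1}).
Local Notation N := n.+1.
Local Notation ratP r s := (fspan_pred (@ratmon K N r s)).
Implicit Types (x : GL K N) (tau : K).

Definition torus_mx tau : 'M[K]_N := diag_mx (\row_i if i \in P then tau else 1).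

(** The value at tau = 0 is a junk identity matrix. *)
Definition torus tau : GL K N := insubd (gl_one K N) (torus_mx tau).

Lemma det_torus_mx tau : \det (torus_mx tau) = tau ^+ #|P|.
Proof.
rewrite det_diag -prodr_const [RHS]big_mkcond; apply: eq_bigr => i _.
by rewrite mxE.
Qed.

Lemma val_torus tau : tau != 0 -> val (torus tau) = torus_mx tau.
Proof.
by move=> t0; rewrite val_insubd unitmxE det_torus_mx unitfE expf_neq0.
Qed.

Lemma torusV tau : tau != 0 -> (torus tau)^-1%g = torus tau^-1.
Proof.
move=> t0; apply: (mulgI (torus tau)); rewrite mulgV; apply/esym/val_inj.
rewrite /= !val_torus ?invr_neq0 // mulmx_diag -[RHS]diag_const_mx; congr diag_mx.
by apply/rowP => i; rewrite !mxE; case: ifP; rewrite ?mulr1 ?mulfV.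
Qed.

Lemma torus_mulr x tau i j : tau != 0 ->
  val (x * torus tau)%g i j = val x i j * (if j \in P then tau else 1).
Proof. by move=> t0; rewrite /= val_torus // mul_mx_diag !mxE. Qed.

Lemma torus_mulrV x tau i j : tau != 0 ->
  val (x * torus tau)^-1%g i j = (if i \in P then tau^-1 else 1) * val x^-1%g i j.
Proof.
by move=> t0; rewrite invgM torusV // [val _]/= val_torus ?invr_neq0 // mul_diag_mx !mxE.
Qed.

(** Each factor c_ij contributes tau to a power 0 or 1, each factor d_ij
    contributes tau to a power 0 or -1; tau ^+ s clears the denominators. *)
Lemma rat_torus_poly r s f x : f \in ratP r s ->
  exists2 q : {poly K}, (size q <= (r + s).+1)%N &
    forall tau, tau != 0 -> tau ^+ s * f (x * torus tau)%g = q.[tau].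
Proof.
elim/ratP_ind => [|k f1 f2 [q1 s1 E1] [q2 s2 E2]|u v].
- by exists 0; rewrite ?size_poly0 // => tau _; rewrite mulr0 horner0.
- exists (k *: q1 + q2).
    apply: leq_trans (size_polyD _ _) _; rewrite geq_max s2 andbT.
    exact: leq_trans (size_scale_leq _ _) s1.
  move=> tau t0; rewrite hornerD hornerZ -E1 // -E2 //.
  by rewrite -[(k *: f1 + f2) _]/(k * f1 _ + f2 _) mulrDr mulrCA.
pose q1 := \prod_(t < r) ((val x (tnth u t).1 (tnth u t).2)%:P * 'X^((tnth u t).2 \in P)).
pose q2 := \prod_(t < s) ((val x^-1%g (tnth v t).1 (tnth v t).2)%:P * 'X^((tnth v t).1 \notin P)).
have szf (a : K) (b : bool) : (size (a%:P * 'X^b)%R <= 2)%N.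
  rewrite mul_polyC; apply: leq_trans (size_scale_leq _ _) _.
  by rewrite size_polyXn; case: b.
have szp m (F : 'I_m -> {poly K}) : (forall i, size (F i) <= 2)%N -> (size (\prod_i F i)%R <= m.+1)%N.
  move=> F2; apply: leq_trans (size_prod_leq _ _) _; rewrite card_ord.
  have : (\sum_(i < m) size (F i) <= \sum_(i < m) 2)%N by apply: leq_sum.
  by rewrite sum_nat_const card_ord leq_subLR addnS ltnS addnn -muln2.
exists (q1 * q2).
  apply: leq_trans (size_polyMleq q1 q2) _.
  have : (size q1 <= r.+1)%N by apply: szp => t; apply: szf.
  have : (size q2 <= s.+1)%N by apply: szp => t; apply: szf.
  lia.
move=> tau t0; rewrite hornerM /wmon mulrCA; congr (_ * _).
  rewrite horner_prod; apply: eq_bigr => t _; rewrite torus_mulr // hornerM hornerC hornerXn.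
  by case: (_ \in P).
have -> : tau ^+ s = \prod_(t < s) tau by rewrite prodr_const card_ord.
rewrite -big_split horner_prod; apply: eq_bigr => t _ /=.
rewrite torus_mulrV // hornerM hornerC hornerXn mulrA [RHS]mulrC; congr (_ * _).
by case: (_ \in P); rewrite /= ?mulfV ?mulr1.
Qed.

End Torus.

Section Vanishing.
Variables (K : closedFieldType) (n r s : nat).
Local Notation N := n.+1.
Local Notation d := (r + n * s)%N.

Lemma poly_eq0_horner (p : {poly K}) : (forall z, p.[z] = 0) -> p = 0.
Proof.
move=> p0; apply/eqP; apply: contraT => /closed_nonrootP [z].
by rewrite /root p0 eqxx.
Qed.

(** With P = R^+ and w = \sum_(i in P) l i, semi-invariance gives
    tau^(|P| s) q(tau) = tau^(s + w) g(x), where q has degree at most r + s. The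
    right-hand side has too large a degree as soon as |P| s + r < w. *)
Lemma detmul_semi_inv_eq0 (l : domwt N d) (g : ratcoord K N r s) :
  (r + #|Rplus s l| * s < \sum_(i in Rplus s l) l i)%N ->
  detmul g \in ind_space K l -> g = 0.
Proof.
set P := Rplus s l; set w := (\sum_(i in P) l i)%N => lw /ind_spaceP gP.
apply: ratcoord_eqP => x; rewrite -[RHS]/(0 : K).
have [q sq qE] := rat_torus_poly P x (valP g).
have E tau : tau != 0 -> tau ^+ (#|P| * s) * q.[tau] = tau ^+ (s + w) * g x.
  move=> t0; rewrite -qE //.
  have U : upper_tri (torus P tau).
    apply/is_trig_mxP => i j ij; rewrite mxE val_torus // !mxE.
    by rewrite -val_eqE /= gtn_eqF.
  have := gP x _ U; rewrite /= !det_mulmx val_torus // det_torus_mx.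
  have -> : \prod_i torus_mx P tau i i ^+ l i = tau ^+ w.
    rewrite /w -prodrXr [RHS]big_mkcond; apply: eq_bigr => i _.
    by rewrite !mxE eqxx mulr1n; case: ifP => // _; rewrite expr1n.
  have dx : \det (val x) ^+ s != 0 by rewrite expf_neq0 // -unitfE -unitmxE (valP x).
  rewrite exprMn -exprM => Ex; apply: (mulfI dx); rewrite exprD.
  rewrite [X in _ * X = _]mulrCA [LHS]mulrCA [X in _ * X = _]mulrA [X in _ * X = _]Ex.
  by rewrite [X in _ * X = _]mulrCA [LHS]mulrCA -[X in _ = _ * X]mulrA.
(* The extra factor 'X makes the identity hold at tau = 0 as well. *)
have p0 : 'X^((#|P| * s).+1) * q - (g x)%:P * 'X^((s + w).+1) = 0.
  apply: poly_eq0_horner => z; rewrite hornerD hornerN !hornerM !hornerXn hornerC.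
  have [->|z0] := eqVneq z 0; first by rewrite !exprS !mul0r mulr0 subr0.
  by rewrite !exprS -mulrA E // [g x * _]mulrC mulrA subrr.
have := congr1 (fun p : {poly K} => p`_(s + w).+1) p0.
rewrite coefB coef0 coefCM coefXn eqxx mulr1 nth_default ?sub0r.
  by move=> /eqP; rewrite oppr_eq0 => /eqP.
apply: leq_trans (size_polyMleq _ q) _; rewrite size_polyXn addSn /=.
apply: leq_trans (_ : ((#|P| * s).+1 + (r + s).+1 <= _)%N); first by rewrite leq_add2l.
by lia.
Qed.

End Vanishing.

(** * Linear forms, coordinates and spans *)
Section LinearAlgebra.
Variable K : fieldType.

Lemma separating_form (V : vectType K) (U : {vspace V}) (v : V) : v \notin U ->
  exists2 f : 'Hom(V, K^o), (forall u, u \in U -> f u = 0) & f v != 0.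
Proof.
move=> vU; pose p := daddv_pi (U^C)%VS U.
have cap : (U^C :&: U = 0)%VS by rewrite capvC capv_compl.
have dec w : p w + daddv_pi U (U^C)%VS w = w.
  by apply: daddv_pi_add => //; rewrite addvC addv_complf memvf.
have pU u : u \in U -> p u = 0.
  by move=> uU; apply: (addIr (daddv_pi U (U^C)%VS u)); rewrite dec daddv_pi_id ?add0r ?capv_compl.
have pv : p v != 0.
  by apply: contra vU => /eqP p0; rewrite -(dec v) p0 add0r memv_pi.
have [i ci] : exists i, coord (vbasis fullv) i (p v) != 0.
  apply/not_existsP => H; case/negP: pv; apply/eqP.
  rewrite (coord_vbasis (memvf (p v))) big1 // => i _.
  by have /negP/negPn/eqP -> := H i; rewrite scale0r.
have fL : linear (fun w => coord (vbasis fullv) i (p w) : K^o).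
  by move=> k a b; rewrite !linearP.
pose fl : {linear V -> K^o} := HB.pack (fun w => coord (vbasis fullv) i (p w) : K^o)
   (GRing.isLinear.Build K V K^o _ _ fL).
exists (linfun fl) => [u uU|]; rewrite lfunE //=.
by rewrite pU // linear0.
Qed.

Lemma bidual_eval (V : vectType K) (ev : 'Hom('Hom(V, K^o), K^o)) :
  exists v : V, forall f, ev f = f v.
Proof.
pose X := vbasis {:V}.
have cL i : linear (coord X i : V -> K^o) by move=> k a b; rewrite linearP.
pose e i : 'Hom(V, K^o) :=
  linfun (HB.pack (coord X i : V -> K^o) (GRing.isLinear.Build K V K^o _ _ (cL i))
   : {linear V -> K^o}).
exists (\sum_(i < \dim {:V}) (ev (e i) : K) *: X`_i) => f.
have fE : f = \sum_(i < \dim {:V}) (f X`_i : K) *: e i.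
  apply/lfunP => w; rewrite sum_lfunE {1}(coord_vbasis (memvf w)) linear_sum.
  by apply: eq_bigr => i _; rewrite scale_lfunE lfunE linearZ /= [RHS]mulrC.
rewrite {1}fE !linear_sum; apply: eq_bigr => i _.
rewrite [LHS]linearZ [RHS]linearZ; exact: (@mulrC K (f X`_i) (ev (e i))).
Qed.

Lemma codom_spanP (V : vectType K) (I : finType) (b : I -> V) v :
  v \in <<codom b>>%VS -> exists c : I -> K, v = \sum_i c i *: b i.
Proof.
move=> vb; have := coord_span (X := codom_tuple b) vb => E.
exists (fun i => coord (codom_tuple b) (enum_rank i) v).
rewrite {1}E (reindex (@enum_rank I)) /=; last exact: onW_bij (@enum_rank_bij I).
by apply: eq_bigr => i _; rewrite nth_codom enum_rankK.
Qed.

Lemma codom_free_eq0 (V : vectType K) (I : finType) (b : I -> V) (c : I -> K) :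
  free (codom b) -> \sum_i c i *: b i = 0 -> forall i, c i = 0.
Proof.
move=> /(@freeP _ _ _ (codom_tuple b)) H c0 i.
rewrite -(enum_rankK i); apply: (H (fun k => c (enum_val k))); rewrite -[RHS]c0.
rewrite (reindex (@enum_rank I)) /=; last exact: onW_bij (@enum_rank_bij I).
by apply: eq_bigr => j _; rewrite nth_codom enum_rankK.
Qed.

End LinearAlgebra.

(** * The kernel of the quotient map *)

(** All the excess of l sits in an initial segment i <= k of indices with
    l i > s, over which the sum of l is at most that of kap. *)
Lemma sum_excess_dominates n d s (kap l : domwt n d) : dominates kap l ->
  (\sum_i (l i - s) <= \sum_i (kap i - s))%N.
Proof.
move=> /forallP dom; case: (pickP (mem (Rplus s l))) => [i0 i0P|R0]; last first.
  by rewrite big1 // => i _; move: (R0 i); rewrite !inE; lia.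
pose k := [arg max_(i > i0 in Rplus s l) (i : nat)].
have [kP kmax] : k \in Rplus s l /\ forall i, i \in Rplus s l -> (i <= k)%N.
  by rewrite /k; case: arg_maxnP.
rewrite (bigID (fun i : 'I_n => (i <= k)%N)) /= [X in (_ + X <= _)%N]big1 ?addn0; last first.
  by move=> i ik; case: (ltnP s (l i)) => [sl|]; [case/negP: ik; apply: kmax; rewrite inE | lia].
apply: (@leq_trans (\sum_(i < n | i <= k) (kap i - s))%N); last first.
  by rewrite [X in (_ <= X)%N](bigID (fun i : 'I_n => (i <= k)%N)) /= leq_addr.
rewrite -(leq_add2r (\sum_(i < n | (i <= k)%N) s)) -!big_split /=.
apply: leq_trans (_ : (\sum_(i < n | (i <= k)%N) kap i <= _)%N); last first.
  by apply: leq_sum => i _; lia.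
apply: leq_trans (dom k); apply/eq_leq/eq_bigr => i ik; rewrite subnK //.
have ki : (l k <= l i)%N by exact: domwt_decr.
by apply: leq_trans ki; move: kP; rewrite inE => /ltnW.
Qed.

Section CellBelow.
Variables (K : fieldType) (A : falgType K) (disp : Order.disp_t) (L : finPOrderType disp).
Variables (M : L -> finType) (C : forall l, M l -> M l -> A).

Lemma cell_below_lin (V : vectType K) (f : {linear A -> V}) (W : {vspace V}) l :
  (forall p : {l : L & (M l * M l)%type}, (tag p < l)%O -> f (cell_elt C p) \in W) ->
  forall w, w \in cell_below C l -> f w \in W.
Proof.
move=> H w; have /subvP sub : (cell_below C l <= linfun f @^-1: W)%VS.
  apply/span_subvP => v /imageP [p pl ->]; rewrite -memv_preim lfunE /=.
  exact: H.
by move=> /sub; rewrite -memv_preim lfunE.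
Qed.

End CellBelow.

Section Quotient.
Variables (K : closedFieldType) (n r s : nat).
Local Notation N := n.+1.
Local Notation d := (r + n * s)%N.
Local Notation quot := (@schur_quot K n r s).

Lemma schur_quotE xi g : quot xi g = xi (detmul g).
Proof. by rewrite lfunE. Qed.

Fact schur_quot_linear : linear quot.
Proof.
move=> k a b; apply/lfunP => g.
by rewrite add_lfunE scale_lfunE !schur_quotE add_lfunE scale_lfunE.
Qed.
HB.instance Definition _ :=
  GRing.isLinear.Build K (schur K N d) (ratschur K N r s) _ quot schur_quot_linear.

Lemma detmul_inj : injective (@detmul K n r s).
Proof.
move=> f g E; apply: ratcoord_eqP => x.
have := congr1 (fun h : polcoord K N d => h x) E; apply: mulfI.
by rewrite expf_neq0 // -unitfE -unitmxE (valP x).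
Qed.

(** A linear section of the quotient map, by extending linear forms along the
    injective map [detmul]. *)
Definition schur_lift (eta : ratschur K N r s) : schur K N d :=
  (eta \o (linfun (@detmul K n r s))^-1)%VF.

Fact schur_lift_linear : linear schur_lift.
Proof.
move=> k a b; apply/lfunP => f.
by rewrite add_lfunE scale_lfunE !comp_lfunE add_lfunE scale_lfunE.
Qed.
HB.instance Definition _ :=
  GRing.isLinear.Build K (ratschur K N r s) (schur K N d) _ schur_lift schur_lift_linear.

Lemma schur_liftK : cancel schur_lift quot.
Proof.
move=> eta; apply/lfunP => g; rewrite schur_quotE comp_lfunE; congr (eta _).
have := lker0_lfunK (f := linfun (@detmul K n r s)) _ g; rewrite lfunE; apply.
by apply/lker0P => a b; rewrite !lfunE; apply: detmul_inj.
Qed.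

(** If every form vanishing on D^s A(N,r,s) vanishes at f, then f belongs
    to D^s A(N,r,s), where [detmul_semi_inv_eq0] applies. *)
Lemma ind_space_detected (l : domwt N d) (f : polcoord K N d) :
  ~~ admissible r s l -> f \in ind_space K l ->
  (forall xi : schur K N d, quot xi = 0 -> xi f = 0) -> f = 0.
Proof.
rewrite -ltnNge => lP fl ker.
have : f \in limg (linfun (@detmul K n r s)).
  apply: contraT => /separating_form [xi xi0 /negP []].
  apply/eqP/ker/lfunP => g; rewrite schur_quotE lfunE /= xi0 //.
  by have := memv_img (linfun (@detmul K n r s)) (memvf g); rewrite lfunE.
case/memv_imgP => g _; rewrite lfunE /= => fg.
have g0 : g = 0 by apply: (detmul_semi_inv_eq0 lP); rewrite -fg.
by rewrite fg g0 linear0.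
Qed.

(** A linear form on the Weyl module is evaluation at some semi-invariant f. If
    it kills I Delta(l), then I f = 0, so I vanishes at f. *)
Lemma weyl_act_ker_generates (l : domwt N d) (U : {vspace weyl K l}) :
  ~~ admissible r s l ->
  (forall xi phi, quot xi = 0 -> weyl_act xi phi \in U) -> U = fullv.
Proof.
move=> lP actU; apply/eqP; rewrite eqEsubv subvf; apply/subvP => phi _.
apply: contraT => /separating_form [ev evU /negP []]; apply/eqP.
have [[f fl] evE] := bidual_eval ev.
rewrite evE; suff f0 : f = 0.
  by have -> : Subvs fl = 0; [apply: val_inj | rewrite linear0].
apply: (ind_space_detected lP fl) => xi xi0.
have lf0 : lconv xi f = 0.
  suff E : Subvs (lconv_ind_space xi fl) = 0 by have := congr1 val E.
  apply/eqP; rewrite -memv0; apply: contraT => /separating_form [psi _ /negP []].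
  by rewrite -weyl_actE -evE evU // actU.
have rf : rtrans 1%g f = f by apply: ratcoord_eqP => x /=; rewrite mulg1.
have := congr1 (fun g : polcoord K N d => g 1%g) lf0.
by rewrite -[LHS]/(xi (rtrans 1%g f)) rf.
Qed.

End Quotient.

Lemma weyl_act_sum (K : fieldType) n d (l : domwt n.+1 d) (xi : schur K n.+1 d)
    (I : finType) (y : I -> K) (v : I -> weyl K l) :
  weyl_act xi (\sum_i y i *: v i) = \sum_i y i *: weyl_act xi (v i).
Proof.
apply/lfunP => -[f fl]; rewrite weyl_actE !sum_lfunE; apply: eq_bigr => i _.
by rewrite !scale_lfunE weyl_actE.
Qed.

(** * Descent of the cellular structure *)
Section CellQuotient.
Variables (K : closedFieldType) (n r s : nat).
Local Notation N := n.+1.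
Local Notation d := (r + n * s)%N.
Local Notation S := (schur K N d).
Local Notation quot := (@schur_quot K n r s).
Variables (M : domwt N d -> finType) (C : forall l, M l -> M l -> S).
Hypothesis Ccell : cellular_basis C.
Hypothesis Ciso : forall l, cell_module_iso C l (@weyl_act K n d l).

Lemma inadmissible_dominates (kap l : domwt N d) :
  ~~ admissible r s l -> (kap <= l)%O -> ~~ admissible r s kap.
Proof.
rewrite !admissibleE -!ltnNge domwt_leE => lP /(sum_excess_dominates s).
exact: leq_trans.
Qed.

(** Fix T'. Modulo the cells above l, which lie in I by induction, the map
    v i |-> C i T' commutes with the action of the algebra; so the elements of
    Delta(l) that it sends into I include I Delta(l), which is everything. *)
Lemma schur_quot_cell0 l (T T' : M l) : ~~ admissible r s l -> quot (C T T') = 0.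
Proof.
have [m] := ubnP #|[pred k : domwt N d | (k < l)%O]|.
elim: m l T T' => // m IH l T T' lm lP.
have belowK w : w \in cell_below C l -> quot w = 0.
  move=> wl; apply/eqP; rewrite -memv0; move: w wl.
  apply: cell_below_lin => -[k [S1 S2]] /= kl; rewrite memv0; apply/eqP.
  apply: IH; last exact: inadmissible_dominates lP (ltW kl).
  rewrite ltnS in lm; apply: leq_trans lm; apply: proper_card; apply/properP; split.
    by apply/subsetP => j; rewrite !inE => /lt_trans; apply.
  by exists k; rewrite !inE ?ltxx.
have [v vB vact] := Ciso l.
have [_ _ /(_ l) coefs] := Ccell.
(* Existence of coefficients, rather than a map on the basis, makes closure
   under linear combinations immediate; they are unique since v is free. *)
pose pU : {pred weyl K l} := fun phi => `[< exists2 x : M l -> K,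
  phi = \sum_i x i *: v i & quot (\sum_i x i *: C i T') = 0 >].
have pU_submod : submod_closed pU.
  split; first by apply/asboolP; exists (fun=> 0); rewrite big1 ?linear0 // => i _; rewrite scale0r.
  move=> k a b /asboolP [x -> x0] /asboolP [y -> y0]; apply/asboolP.
  exists (fun i => k * x i + y i).
    by rewrite scaler_sumr -big_split; apply: eq_bigr => i _; rewrite scalerDl scalerA.
  rewrite (_ : \sum_i _ = k *: (\sum_i x i *: C i T') + \sum_i y i *: C i T').
    by rewrite linearP /= x0 y0 scaler0 addr0.
  by rewrite scaler_sumr -big_split; apply: eq_bigr => i _; rewrite scalerDl scalerA.
have [U UE] := vspace_of_submod pU_submod.
have Ufull : U = fullv.
  apply: (weyl_act_ker_generates lP) => a phi a0; rewrite UE.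
  have [y ->] : exists y : M l -> K, phi = \sum_i y i *: v i.
    by apply: codom_spanP; have /andP [/eqP -> _] := vB; exact: memvf.
  have [c cE] := coefs a.
  apply/asboolP; exists (fun j => \sum_i y i * c j i).
    rewrite weyl_act_sum; under eq_bigr => i _ do rewrite (vact _ _ cE) scaler_sumr.
    rewrite exchange_big; apply: eq_bigr => j _ /=; rewrite scaler_suml.
    by apply: eq_bigr => i _; rewrite scalerA.
  have -> : \sum_j (\sum_i y i * c j i) *: C j T' =
      \sum_i y i *: (a * C i T' - (a * C i T' - \sum_j c j i *: C j T')).
    under [RHS]eq_bigr => i _ do rewrite subKr scaler_sumr.
    rewrite exchange_big; apply: eq_bigr => j _ /=; rewrite scaler_suml.
    by apply: eq_bigr => i _; rewrite scalerA.
  rewrite linear_sum big1 // => i _.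
  by rewrite linearZ linearB /= (belowK _ (cE _ _)) subr0 schur_quotM a0 mul0r scaler0.
have : v T \in U by rewrite Ufull memvf.
rewrite UE => /asboolP [x xE x0].
have xT : forall i, x i - (i == T)%:R = 0.
  apply: (codom_free_eq0 (b := v)); first by case/andP: vB.
  under eq_bigr => i _ do rewrite scalerBl.
  rewrite sumrB -xE (bigD1 T) //= eqxx scale1r big1 ?addr0 ?subrr // => i /negbTE ->.
  by rewrite scale0r.
rewrite -x0 (bigD1 T) //= big1 ?addr0 => [|i /negbTE iT].
  by have /eqP := xT T; rewrite eqxx subr_eq0 => /eqP ->; rewrite scale1r.
by have /eqP := xT i; rewrite iT subr0 => /eqP ->; rewrite scale0r.
Qed.

Local Notation quotC := (fun (l : ratwt n r s) T T' => quot (@C (val l) T T')).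

Lemma dim_cell_pairs : (\sum_l #|M l| ^ 2 = \dim {:polcoord K N d})%N.
Proof.
have [/dim_basis_codom H _ _] := Ccell.
by rewrite -card_pairs_in -H; apply: dim_dual.
Qed.

Lemma card_cell_index l : #|M l| = \dim (ind_space K l).
Proof.
have [v /dim_basis_codom <- _] := Ciso l.
by rewrite -[LHS]/(\dim {:'Hom(subvs_of (ind_space K l), K^o)}) dim_dual dimvf.
Qed.

Lemma schur_quot_span (x : S) : quot x \in <<codom (cell_elt quotC)>>%VS.
Proof.
have [/andP [/eqP Cspan _] _ _] := Ccell.
have [c ->] : exists c, x = \sum_p c p *: cell_elt C p.
  by apply: codom_spanP; rewrite Cspan memvf.
rewrite linear_sum; apply: rpred_sum => -[l [T T']] _; rewrite linearZ; apply: rpredZ.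
case: (boolP (admissible r s l)) => lP; last by rewrite /cell_elt /= schur_quot_cell0 ?mem0v.
exact: (memv_span (codom_f (cell_elt quotC)
  (Tagged (fun l : ratwt n r s => (M (val l) * M (val l))%type) (i := Sub l lP) (T, T')))).
Qed.

(** The images of the admissible cells span because the others vanish, and they
    are no more numerous than the dimension. *)
Lemma schur_quot_basis : basis_of fullv (codom (cell_elt quotC)).
Proof.
rewrite basisEdim; apply/andP; split.
  by apply/subvP => eta _; rewrite -(schur_liftK eta) schur_quot_span.
rewrite size_codom card_pairs_in.
rewrite [\dim _](dim_dual (ratcoord K N r s)).
exact: (sum_sqr_le_dim_ratcoord card_cell_index dim_cell_pairs).
Qed.

(** By independence of the images of the admissible cells, I is spanned by the
    inadmissible ones, and iota permutes these. *)
Lemma schur_quot_anti (iota : {linear S -> S}) :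
  (forall l (T T' : M l), iota (C T T') = C T' T) ->
  forall x, quot x = 0 -> quot (iota x) = 0.
Proof.
move=> iotaC x; have [/andP [/eqP Cspan _] _ _] := Ccell.
have [c ->] : exists c, x = \sum_p c p *: cell_elt C p.
  by apply: codom_spanP; rewrite Cspan memvf.
have /andP [_ free] := schur_quot_basis.
rewrite linear_sum => c0.
pose emb (q : {l : ratwt n r s & (M (val l) * M (val l))%type}) :
  {l : domwt N d & (M l * M l)%type} := Tagged (fun l => (M l * M l)%type) (tagged q).
have cq q : c (emb q) = 0.
  apply: (codom_free_eq0 (c := fun q => c (emb q)) free); rewrite -[RHS]c0.
  pose F (l : domwt N d) (m : M l * M l) : ratschur K N r s :=
    c (Tagged (fun l => (M l * M l)%type) m) *: quot (C m.1 m.2).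
  transitivity (\sum_(l : ratwt n r s) \sum_(m : M (val l) * M (val l)) F (val l) m).
    rewrite (sig_big_dep xpredT (fun _ => xpredT) (fun l : ratwt n r s => F (val l))).
    by apply: eq_bigr => -[l m].
  transitivity (\sum_(l : domwt N d) \sum_(m : M l * M l) F l m); last first.
    rewrite (sig_big_dep xpredT (fun _ => xpredT) F).
    by apply: eq_bigr => -[l m] _; rewrite [RHS]linearZ.
  rewrite [RHS](bigID (fun l : domwt N d => admissible r s l)) /= [X in _ + X]big1 ?addr0; last first.
    by move=> l lP; rewrite big1 // => m _; rewrite /F schur_quot_cell0 ?scaler0.
  rewrite [RHS](reindex_omap (val : ratwt n r s -> _) insub) /=; last first.
    by move=> l lP; rewrite insubT.
  by apply: eq_bigl => l; rewrite valK eqxx andbT; symmetry; apply: (valP l).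
rewrite !linear_sum big1 // => -[l [T T']] _ /=; rewrite !linearZ /= iotaC.
case: (boolP (admissible r s l)) => lP; last by rewrite /cell_elt /= schur_quot_cell0 ?scaler0.
have cq' := cq (Tagged (fun l : ratwt n r s => (M (val l) * M (val l))%type)
  (i := Sub l lP) (T, T')).
by rewrite [c _]cq' scale0r.
Qed.

Theorem schur_quot_cellular : cellular_basis quotC.
Proof.
have [_ [iota iotaM iotaC] coefs] := Ccell.
split; first exact: schur_quot_basis.
  pose iota' : {linear ratschur K n.+1 r s -> ratschur K n.+1 r s} :=
    @schur_quot K n r s \o (iota \o @schur_lift K n r s).
  have iotaE x : iota' (schur_quot x) = schur_quot (iota x).
    have x0 : schur_quot (schur_lift (schur_quot x) - x) = 0.
      by rewrite linearB /= schur_liftK subrr.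
    apply/eqP; rewrite -subr_eq0; apply/eqP.
    by have := schur_quot_anti iotaC x0; rewrite !linearB.
  exists iota' => [x y|l T T']; last by rewrite iotaE iotaC.
  rewrite -(schur_liftK x) -(schur_liftK y) -schur_quotM !iotaE.
  by rewrite iotaM schur_quotM.
move=> l a; have [c cE] := coefs (val l) (schur_lift a).
exists c => T T'; rewrite -{1}(schur_liftK a) -schur_quotM.
have -> : \sum_S' c S' T *: schur_quot (@C (val l) S' T') =
    schur_quot (\sum_S' c S' T *: @C (val l) S' T').
  by rewrite linear_sum; apply: eq_bigr => S' _; rewrite linearZ.
rewrite -linearB; move: (cE T T'); apply: cell_below_lin => -[k [S1 S2]] /= kl.
case: (boolP (admissible r s k)) => kP; last first.
  by rewrite /cell_elt /= schur_quot_cell0 ?mem0v.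
apply/memv_span/imageP.
by exists (Tagged (fun l : ratwt n r s => (M (val l) * M (val l))%type) (i := Sub k kP) (S1, S2)).
Qed.

End CellQuotient.

Local Close Scope ring_scope.

Theorem corollary3p2 (K : closedFieldType) (n r s : nat)
  (M : domwt n.+1 (r + n * s) -> finType)
  (C : forall l, M l -> M l -> schur K n.+1 (r + n * s)) :
  cellular_basis C ->
  (forall l, cell_module_iso C l (@weyl_act K n (r + n * s) l)) ->
  cellular_basis (fun (l : ratwt n r s) S T => schur_quot (C (val l) S T)).
Proof. exact: schur_quot_cellular. Qed.
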